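(* Let $(u_n,\rho_n,\mu_n)\in\mathcal D$, $n\in\mathbb N$, be a sequence and let $(u,\rho,\mu)\in\mathcal D$ be such that $(u_n,\rho_n,\mu_n)$ converges to $(u,\rho,\mu)$ as $n\to\infty$ in the sense defined in the context (convergence in $\mathcal D$). Let $X_n=(y_n,U_n,h_n,r_n)=L((u_n,\rho_n,\mu_n))\in\mathcal F_0$ and $X=(y,U,h,r)=L((u,\rho,\mu))\in\mathcal F_0$. Then $X_n\to X$ in $E$ as $n\to\infty$.
   Context: **Eulerian coordinates.** $L^2_{\rm const}(\mathbb R)$ is the set of $\rho\in L^1_{\rm loc}(\mathbb R)$ of the form $\rho=\bar\rho+k$ with $\bar\rho\in L^2(\mathbb R)$, $k\in\mathbb R$; the pair $(\bar\rho,k)$ is uniquely determined by $\rho$. The set $\mathcal D$ consists of all triples $(u,\rho,\mu)$ such that $u\in H^1(\mathbb R)$, $\rho=\bar\rho+k\in L^2_{\rm const}(\mathbb R)$, and $\mu$ is a positive finite Radon measure on $\mathbb R$ whose absolutely continuous part is $\mu_{\rm ac}=(u_x^2+\bar\rho^2)\,dx$. **Convergence in $\mathcal D$.** A sequence $(u_n,\rho_n,\mu_n)\in\mathcal D$, $\rho_n=\bar\rho_n+k_n$, converges to $(u,\rho,\mu)\in\mathcal D$, $\rho=\bar\rho+k$, if, with $F_n(x)=\mu_n((-\infty,x])$, $F(x)=\mu((-\infty,x])$, $F_n(\infty)=\mu_n(\mathbb R)$, $F(\infty)=\mu(\mathbb R)$, as $n\to\infty$: (i) $u_n\to u$ in $L^2(\mathbb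 R)\cap L^\infty(\mathbb R)$; (ii) $u_{n,x}\rightharpoonup u_x$ weakly in $L^2(\mathbb R)$; (iii) $\bar\rho_n\rightharpoonup\bar\rho$ weakly in $L^2(\mathbb R)$; (iv) $k_n\to k$; (v) $\int_{\mathbb R}\frac{u_{n,x}^2}{1+u_{n,x}^2+\bar\rho_n^2}dx\to\int_{\mathbb R}\frac{u_x^2}{1+u_x^2+\bar\rho^2}dx$; (vi) $\int_{\mathbb R}\frac{\bar\rho_n^2}{1+u_{n,x}^2+\bar\rho_n^2}dx\to\int_{\mathbb R}\frac{\bar\rho^2}{1+u_x^2+\bar\rho^2}dx$; (vii) $F_n(x)\to F(x)$ for every $x$ at which $F$ is continuous; (viii) $F_n(\infty)\to F(\infty)$. **Lagrangian coordinates.** $V=\{f\in C_b(\mathbb R): f_\xi\in L^2(\mathbb R)\}$ with $\|f\|_V=\|f\|_{L^\infty}+\|f_\xi\|_{L^2}$, where $C_b(\mathbb R)=C(\mathbb R)\cap L^\infty(\mathbb R)$. $E=V\times H^1(\mathbb R)\times L^2(\mathbb R)\times L^2(\mathbb R)\times\mathbb R$ with norm $\|(\zeta,U,h,\bar r,k)\|_E=\|\zeta\|_V+\|U\|_{H^1}+\|h\|_{L^2}+\|\bar r\|_{L^2}+|k|$. A tuple $(\zeta,U,h,\bar r,k)\in E$ is identified with $(y,U,h,r)$, where $y=\zeta+\mathrm{Id}$ and $r=\bar r+k y_\xi$; convergence in $E$ refers to $(\zeta,U,h,\bar r,k)$. The set $\mathcal F_0$ consists of all $X=(y,U,h,r)\in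 E$ such that $\zeta,U\in W^{1,\infty}(\mathbb R)$, $h,r\in L^\infty(\mathbb R)$; $y_\xi\ge0$, $h\ge0$, $y_\xi+h>0$ a.e.; $y_\xi h=U_\xi^2+\bar r^2$ a.e.; and $y(\xi)+H(\xi)=\xi$ for all $\xi\in\mathbb R$, where $H(\xi)=\int_{-\infty}^\xi h(\eta)\,d\eta$. **The map $L:\mathcal D\to\mathcal F_0$.** For $(u,\rho,\mu)\in\mathcal D$, $\rho=\bar\rho+k$, $L((u,\rho,\mu))=(y,U,h,r)$ is given by $$y(\xi)=\sup\{y\mid \mu((-\infty,y))+y<\xi\},\quad h(\xi)=1-y_\xi(\xi),\quad U(\xi)=u(y(\xi)),\quad r(\xi)=\rho(y(\xi))\,y_\xi(\xi)$$ (with $r=0$ where $y_\xi=0$); here $\bar r(\xi)=\bar\rho(y(\xi))y_\xi(\xi)$ and the constant $k$ in $E$ is the constant $k$ of $\rho$. It is known that $L$ indeed takes values in $\mathcal F_0$. *)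

(* Defs.v *)
From HB Require Import structures.
From mathcomp Require Import all_boot all_order all_algebra.
From mathcomp Require Import all_classical all_reals all_analysis.
Set Implicit Arguments.
Unset Strict Implicit.
Unset Printing Implicit Defensive.
Import Order.TTheory GRing.Theory Num.Theory.
Import numFieldNormedType.Exports.
Local Open Scope classical_set_scope.
Local Open Scope ring_scope.

(* Elements of Lebesgue and Sobolev spaces on the line are represented by     *)
(* (Borel measurable) functions R -> R.                                       *)
Section Spaces.
Context {R : realType}.
Implicit Types (f g phi : R -> R).

Local Notation leb := (@lebesgue_measure R).

Definition L2 f : Prop := f \in Lfun leb 2%:E.

Definition Linfty f : Prop := f \in Lfun leb +oo%E.

Definition norm_L2 f : \bar R := ('N[leb]_2%:E[EFin \o f])%E.

Definition norm_Linfty f : \bar R := ('N[leb]_+oo[EFin \o f])%E.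

(* Test functions are taken in C^1_c; testing against C^oo_c instead gives    *)
(* the same weak derivatives, by mollification.                               *)
Definition test_function phi : Prop :=
  [/\ forall x, derivable phi x 1,
      continuous (derive1 phi) &
      exists M : R, forall x, M < `|x| -> phi x = 0].

Definition is_weak_derivative f g : Prop :=
  [/\ locally_integrable setT f,
      locally_integrable setT g &
      forall phi, test_function phi ->
        \int[leb]_x (f x * derive1 phi x) = - \int[leb]_x (g x * phi x)].

Definition weakly_differentiable f : Prop := exists g, is_weak_derivative f g.

(* The weak derivative is unique up to a null set; [wderiv f] is one          *)
(* representative of it. It is meaningless (constant 0) unless f is           *)
(* weakly differentiable.                                                     *)
Definition wderiv f : R -> R := xget (cst 0) [set g | is_weak_derivative f g].

(* f is required to be the continuous representative of its class, because    *)
(* u is evaluated pointwise in U = u o y.                                     *)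
Definition H1 f : Prop :=
  [/\ continuous f, L2 f, weakly_differentiable f & L2 (wderiv f)].

Definition norm_H1 f : \bar R :=
  ((norm_L2 f ^+ 2 + norm_L2 (wderiv f) ^+ 2) `^ 2^-1)%E.

Definition W1infty f : Prop :=
  [/\ Linfty f, weakly_differentiable f & Linfty (wderiv f)].

Definition V f : Prop :=
  [/\ continuous f, Linfty f, weakly_differentiable f & L2 (wderiv f)].

Definition norm_V f : \bar R := (norm_Linfty f + norm_L2 (wderiv f))%E.

Definition weak_cvg_L2 (fn : nat -> R -> R) f : Prop :=
  forall phi, L2 phi ->
    \int[leb]_x (fn n x * phi x) @[n --> \oo] --> \int[leb]_x (f x * phi x).

Definition mutually_singular (m1 m2 : set (measurableTypeR R) -> \bar R) :=
  exists A : set (measurableTypeR R),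
    [/\ measurable A, m1 A = 0%E & m2 (~` A) = 0%E].

(* mac is the absolutely continuous part of mu, in the Lebesgue               *)
(* decomposition of mu with respect to the Lebesgue measure.                  *)
Definition is_ac_part
    (mu mac : {measure set (measurableTypeR R) -> \bar R}) : Prop :=
  mac `<< leb /\
  exists msing : {measure set (measurableTypeR R) -> \bar R},
    mutually_singular leb msing /\
    forall A, measurable A -> mu A = (mac A + msing A)%E.

Definition has_density
    (m : {measure set (measurableTypeR R) -> \bar R}) (g : R -> R) : Prop :=
  forall A, measurable A -> m A = (\int[leb]_(x in A) (g x)%:E)%E.

End Spaces.

(* A function rho in L^2_const is represented by the pair (rhobar, k) that it *)
(* determines. A finite Borel measure on R is automatically Radon.            *)
Record eulerian (R : realType) := Eulerian {
  e_u : R -> R;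
  e_rhobar : R -> R;
  e_k : R;
  e_mu : {finite_measure set (measurableTypeR R) -> \bar R}
}.

(* (zeta, U, h, rbar, k), subsequently identified with (y, U, h, r). *)
Record lagrangian (R : realType) := Lagrangian {
  l_zeta : R -> R;
  l_U : R -> R;
  l_h : R -> R;
  l_rbar : R -> R;
  l_k : R
}.

Section Eulerian.
Context {R : realType}.
Local Notation leb := (@lebesgue_measure R).
Implicit Types d : eulerian R.

Definition e_rho d : R -> R := fun x => e_rhobar d x + e_k d.

Definition e_ux d : R -> R := wderiv (e_u d).

Definition in_D d : Prop :=
  [/\ H1 (e_u d),
      L2 (e_rhobar d) &
      exists mac : {measure set (measurableTypeR R) -> \bar R},
        is_ac_part (e_mu d) mac /\
        has_density mac (fun x => e_ux d x ^+ 2 + e_rhobar d x ^+ 2)].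

Definition e_F d (x : R) : R := fine (e_mu d [set` `]-oo, x]]).

Definition e_Finfty d : R := fine (e_mu d setT).

Definition e_density d (x : R) : R :=
  1 + e_ux d x ^+ 2 + e_rhobar d x ^+ 2.

Record cvg_D (dn : nat -> eulerian R) d : Prop := CvgD {
  cvg_u_L2 : norm_L2 (e_u (dn n) \- e_u d) @[n --> \oo] --> 0%E;
  cvg_u_Linfty : norm_Linfty (e_u (dn n) \- e_u d) @[n --> \oo] --> 0%E;
  cvg_ux : weak_cvg_L2 (fun n => e_ux (dn n)) (e_ux d);
  cvg_rhobar : weak_cvg_L2 (fun n => e_rhobar (dn n)) (e_rhobar d);
  cvg_k : e_k (dn n) @[n --> \oo] --> e_k d;
  cvg_int_ux :
    \int[leb]_x (e_ux (dn n) x ^+ 2 / e_density (dn n) x) @[n --> \oo]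
      --> \int[leb]_x (e_ux d x ^+ 2 / e_density d x);
  cvg_int_rhobar :
    \int[leb]_x (e_rhobar (dn n) x ^+ 2 / e_density (dn n) x) @[n --> \oo]
      --> \int[leb]_x (e_rhobar d x ^+ 2 / e_density d x);
  cvg_F : forall x : R, {for x, continuous (e_F d)} ->
    e_F (dn n) x @[n --> \oo] --> e_F d x;
  cvg_Finfty : e_Finfty (dn n) @[n --> \oo] --> e_Finfty d
}.

End Eulerian.

Section Lagrangian.
Context {R : realType}.
Local Notation leb := (@lebesgue_measure R).
Implicit Types X : lagrangian R.

Definition l_y X : R -> R := fun xi => l_zeta X xi + xi.

Definition l_yxi X : R -> R := wderiv (l_y X).

Definition l_r X : R -> R := fun xi => l_rbar X xi + l_k X * l_yxi X xi.

Definition in_E X : Prop :=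
  [/\ V (l_zeta X), H1 (l_U X), L2 (l_h X) & L2 (l_rbar X)].

Definition l_sub X X' : lagrangian R :=
  Lagrangian (l_zeta X \- l_zeta X') (l_U X \- l_U X') (l_h X \- l_h X')
    (l_rbar X \- l_rbar X') (l_k X - l_k X').

Definition norm_E X : \bar R :=
  (norm_V (l_zeta X) + norm_H1 (l_U X) + norm_L2 (l_h X)
   + norm_L2 (l_rbar X) + `|l_k X|%:E)%E.

Definition cvg_E (Xn : nat -> lagrangian R) X : Prop :=
  norm_E (l_sub (Xn n) X) @[n --> \oo] --> 0%E.

Record in_F0 X : Prop := InF0 {
  F0_E : in_E X;
  F0_zeta : W1infty (l_zeta X);
  F0_U : W1infty (l_U X);
  F0_h : Linfty (l_h X);
  F0_r : Linfty (l_r X);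
  F0_yxi_ge0 : \forall xi \ae leb, 0 <= l_yxi X xi;
  F0_h_ge0 : \forall xi \ae leb, 0 <= l_h X xi;
  F0_gt0 : \forall xi \ae leb, 0 < l_yxi X xi + l_h X xi;
  F0_eq : \forall xi \ae leb,
    l_yxi X xi * l_h X xi = wderiv (l_U X) xi ^+ 2 + l_rbar X xi ^+ 2;
  (* In \bar R, so that the integral H(xi) is forced to be finite. *)
  F0_yH : forall xi : R,
    ((l_y X xi)%:E + \int[leb]_(eta in `]-oo, xi]) (l_h X eta)%:E = xi%:E)%E
}.

End Lagrangian.

Section L.
Context {R : realType}.
Implicit Types d : eulerian R.

Definition L_y d (xi : R) : R :=
  sup [set x : R | (e_mu d [set` `]-oo, x[] + x%:E < xi%:E)%E].

Definition L d : lagrangian R :=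
  let y := L_y d in
  let yxi := wderiv y in
  Lagrangian (fun xi => y xi - xi) (e_u d \o y) (fun xi => 1 - yxi xi)
    (fun xi => e_rhobar d (y xi) * yxi xi) (e_k d).

Lemma l_y_L d : l_y (L d) = L_y d.
Proof. by apply/funext => xi; rewrite /l_y /L /= subrK. Qed.

Lemma l_r_L d xi : l_r (L d) xi = e_rho d (L_y d xi) * l_yxi (L d) xi.
Proof. by rewrite /l_r /l_yxi l_y_L /L /e_rho /= mulrDl. Qed.

End L.

(* Main.v *)
(* Let F(x) = mu((-oo, x]). Then y(xi) <= x iff xi <= x + F(x), so y is        *)
(* nondecreasing and 1-Lipschitz, and it pushes the Lebesgue measure forward  *)
(* to dx + mu. If N is a null set carrying the singular part of mu, and       *)
(* w = 1_{N^c} / (1 + u_x^2 + rhobar^2), it follows that almost everywhere    *)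
(*   y_xi = w(y), h = (1 - w)(y), U_xi = (u_x w)(y), rbar = (rhobar w)(y).    *)
(* These satisfy y_xi h = U_xi^2 + rbar^2, that is, the vector                *)
(* v = (U_xi, rbar, h) lies on the sphere h = |v|^2. Consequently             *)
(*   |v_n - v|^2 = (h_n - h) - 2 <v_n - v, v>,                                *)
(* and strong L^2 convergence of v_n follows from its weak convergence,       *)
(* together with the control of the tails of h_n given by F_n(oo) -> F(oo).   *)
(* Weak convergence is the convergence of the primitives y_n, U_n = u_n(y_n)  *)
(* and the integral of rhobar_n up to y_n, for which y_n -> y suffices.       *)

Require Import Defs.
From HB Require Import structures.
From mathcomp Require Import all_boot all_order all_algebra.
From mathcomp Require Import all_classical all_reals all_analysis.
From mathcomp Require Import measurable_realfun ess_sup_inf ring lra.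
Set Implicit Arguments.
Unset Strict Implicit.
Unset Printing Implicit Defensive.
Import Order.TTheory GRing.Theory Num.Theory.
Import numFieldNormedType.Exports.
Local Open Scope classical_set_scope.
Local Open Scope ring_scope.

(** Write F(x) = mu((-oo, x]). The map y is the generalized inverse of x + F(x) ([L_y_le]): it is
    nondecreasing, 1-Lipschitz, and carries Lebesgue measure to dx + mu ([leb_preimage_L_y]).
    Convergence of F_n at the continuity points of F therefore gives y_n -> y pointwise. Together
    with F_n(oo) -> F(oo), which prevents mass from escaping to infinity, it gives uniform
    convergence ([L_y_cvg_uniform]). This settles zeta in the sup norm. For U, split u_n(y_n) - u(y)
    as (u_n - u)(y_n) + (u(y_n) - u(y)); both terms are small in L^2 ([L_U_cvg_L2]).

    The derivatives need another argument, because u_x and rhobar converge only weakly. The change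
    of variables turns them into a bounded vector v = (U_xi, rbar, h) lying on the sphere h = |v|^2
    ([L_profile_exists]). On this sphere |v_n - v|^2 is affine in v_n ([profile_diffE]), so weak
    convergence on bounded intervals becomes strong convergence there ([profile_diff_itv_cvg]). Off
    a large interval |v_n - v|^2 <= 2 h_n + 2 h, and the tails of h_n are read off from y_n and
    F_n(oo) ([profile_diff_cvg]).

    Weak convergence of v_n means convergence of its integrals over intervals, which
    [bounded_weak_cvg] extends to bounded test functions. The integrals of h_n and U_n,xi are
    increments of xi - y_n and U_n. That of rbar_n is the integral of rhobar_n over ]y_n(a),
    y_n(b)]; moving the endpoints costs little, since the primitives of rhobar_n are uniformly
    1/2-Hoelder ([rhobar_itv_cvg]).

    Since [wderiv] is an arbitrary choice in an almost everywhere class, the work is done with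
    [primitive]; [weak_derivative_primitive], [primitive_weak_derivative] and [wderiv_ae] translate
    between the two. *)

(** * Local integrability and almost everywhere reasoning *)

Section LocallyIntegrable.
Context {R : realType}.
Local Notation leb := (@lebesgue_measure R).
Implicit Types (f g : R -> R).

Lemma locally_integrable_itvcc g (a b : R) : locally_integrable setT g ->
  leb.-integrable `[a, b] (EFin \o g).
Proof.
move=> [mg _ gK]; apply/integrableP; split.
  by apply/measurable_EFinP; apply: measurable_funS mg.
by apply: gK => //; exact: segment_compact.
Qed.

Lemma locally_integrable_itvoc g (a b : R) : locally_integrable setT g ->
  leb.-integrable `]a, b] (EFin \o g).
Proof.
move=> lg; apply: integrableS (locally_integrable_itvcc a b lg) => //.
exact: subset_itv_oc_cc.
Qed.

Lemma itv_locally_integrable g : measurable_fun setT g ->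
  (forall a b : R, leb.-integrable `[a, b] (EFin \o g)) ->
  locally_integrable setT g.
Proof.
move=> mg ig; split => //; first exact: openT.
move=> K _ cK; have [M [_ MK]] := compact_bounded cK.
have KM : K `<=` `[- (`|M| + 1), `|M| + 1].
  move=> x Kx /=; rewrite in_itv/= -ler_norml; apply: (MK (`|M| + 1)) => //.
  by rewrite ltr_pwDr// ler_norm.
have /integrableP[_] := ig (- (`|M| + 1)) (`|M| + 1).
apply: le_lt_trans; apply: ge0_subset_integral => //.
- exact: compact_measurable.
- apply/measurable_EFinP; apply: measurableT_comp => //.
  exact: measurable_funS mg.
Qed.

Lemma bounded_locally_integrable g (M : R) : measurable_fun setT g ->
  (forall x, `|g x| <= M) -> locally_integrable setT g.
Proof.
move=> mg gM; apply: itv_locally_integrable => // a b.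
apply: measurable_bounded_integrable => //.
- exact: compact_finite_measure (@segment_compact _ a b).
- exact: measurable_funS mg.
- exists M; split; first by rewrite num_real.
  by move=> x Mx y _ /=; rewrite (le_trans (gM y))// ltW.
Qed.

Lemma continuous_locally_integrable f : continuous f ->
  locally_integrable setT f.
Proof.
move=> cf; apply: itv_locally_integrable.
  exact: continuous_measurable_fun.
move=> a b; apply: continuous_compact_integrable; first exact: segment_compact.
exact: continuous_subspaceT.
Qed.

Lemma locally_integrable_continuousM f g : locally_integrable setT g ->
  continuous f -> locally_integrable setT (fun x => g x * f x).
Proof.
move=> lg cf; have mf := continuous_measurable_fun cf.
have mg : measurable_fun setT g by case: lg.
apply: itv_locally_integrable; first exact: measurable_funM.
move=> a b; have -> : EFin \o (fun x => g x * f x) =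
    ((EFin \o f) \* (EFin \o g))%E by apply/funext => x /=; rewrite mulrC.
apply: (@integrableMr _ _ _ leb `[a, b]%classic _ f (EFin \o g)) => //.
- exact: measurable_funS mf.
- have : compact (f @` `[a, b]).
    apply: continuous_compact; last exact: segment_compact.
    exact: continuous_subspaceT.
  move=> /compact_bounded[M [Mr MP]]; exists M; split => // x Mx y yab /=.
  by apply: (MP x Mx); exists y.
- exact: locally_integrable_itvcc.
Qed.

Lemma ae_imply (P Q : R -> Prop) : (forall x, P x -> Q x) ->
  {ae leb, forall x, P x} -> {ae leb, forall x, Q x}.
Proof.
by move=> PQ [N [mN N0 PN]]; exists N; split => // x nQ; apply: PN => /PQ.
Qed.

Lemma ae_imply2 (P Q S : R -> Prop) : (forall x, P x -> Q x -> S x) ->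
  {ae leb, forall x, P x} -> {ae leb, forall x, Q x} ->
  {ae leb, forall x, S x}.
Proof.
move=> PQS [N [mN N0 PN]] [M [mM M0 QM]]; exists (N `|` M); split => //.
- exact: measurableU.
- apply/eqP; rewrite -measure_le0 (le_trans (measureU2 _ mN mM))//.
  by rewrite [X in (X + _)%E]N0 [X in (_ + X)%E]M0 adde0.
- move=> x nS; apply: contrapT => /not_orP[/= nN nM]; apply: nS.
  by apply: PQS; apply: contrapT => ?; [apply: nN; apply: PN|apply: nM; apply: QM].
Qed.

End LocallyIntegrable.

(** * Exchange of integrals against a bounded kernel *)

Section Fubini.
Context {R : realType}.
Local Notation leb := (@lebesgue_measure R).
Implicit Types (f g : R -> R).

(** The integrand is dominated by |f(x)| |g(y)|, which is integrable on the product. It is applied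
    to indicator kernels: y <= x for integration by parts, and a sliding window for moving
    averages. *)
Lemma Rintegral_Fubini_kernel f g (K : R * R -> R) :
  leb.-integrable setT (EFin \o f) -> leb.-integrable setT (EFin \o g) ->
  measurable_fun setT K -> (forall z, `|K z| <= 1) ->
  \int[leb]_x (f x * \int[leb]_y (K (x, y) * g y)) =
  \int[leb]_y ((\int[leb]_x (f x * K (x, y))) * g y).
Proof.
move=> If Ig mK K1.
have mf : measurable_fun setT f.
  by apply/measurable_EFinP; exact: measurable_int If.
have mg : measurable_fun setT g.
  by apply/measurable_EFinP; exact: measurable_int Ig.
have Kg x : leb.-integrable setT (EFin \o (fun y => K (x, y) * g y)).
  apply: le_integrable Ig => //.
    apply/measurable_EFinP; apply: measurable_funM => //.
    by apply: measurableT_comp => //; exact: pair1_measurable.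
  by move=> y _ /=; rewrite lee_fin normrM ler_piMl.
have Kf y : leb.-integrable setT (EFin \o (fun x => f x * K (x, y))).
  apply: le_integrable If => //.
    apply/measurable_EFinP; apply: measurable_funM => //.
    by apply: measurableT_comp => //; exact: pair2_measurable.
  by move=> x _ /=; rewrite lee_fin normrM ler_piMr.
pose F (z : R * R) : \bar R := (f z.1 * K z * g z.2)%:E.
have mF : measurable_fun setT F.
  apply/measurable_EFinP; apply: measurable_funM.
    by apply: measurable_funM => //; apply: measurableT_comp => //.
  by apply: measurableT_comp => //.
have iF : (leb \x leb)%E.-integrable setT F.
  apply/integrable12ltyP => //.
  have /integrableP[_ If'] := If; have /integrableP[_ Ig'] := Ig.
  apply: (@le_lt_trans _ _
      (\int[leb]_x (`|f x|%:E * \int[leb]_y `|g y|%:E))%E).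
    apply: ge0_le_integral => //.
    - by move=> x _; exact: integral_ge0.
    - apply: (@measurable_fun_fubini_tonelli_F _ _ _ _ _ leb
        (fun z : R * R => `|F z|%E)) => //.
      exact: measurableT_comp.
    - apply: emeasurable_funM => //; apply/measurable_EFinP.
      exact: measurableT_comp.
    - move=> x _; rewrite -ge0_integralZl//; last first.
        by apply/measurable_EFinP; exact: measurableT_comp.
      apply: ge0_le_integral => //.
      + have mFx := measurableT_comp mF (pair1_measurable x).
        exact: (measurableT_comp _ mFx).
      + apply: emeasurable_funM => //; apply/measurable_EFinP.
        exact: measurableT_comp.
      + move=> y _; rewrite /F /= -EFinM lee_fin !normrM ler_wpM2r//.
        by rewrite ler_piMr.
  rewrite ge0_integralZr//; last 2 first.
  - by apply/measurable_EFinP; exact: measurableT_comp.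
  - exact: integral_ge0.
  apply: lte_mul_pinfty => //; first exact: integral_ge0.
  by rewrite ge0_fin_numE//; exact: integral_ge0.
have Fub := Fubini iF.
congr fine. transitivity (\int[leb]_x \int[leb]_y F (x, y))%E.
  apply: eq_integral => x _; rewrite /F /=.
  under [RHS]eq_integral do rewrite -mulrA EFinM.
  rewrite integralZl//; last exact: Kg.
  by rewrite EFinM /Rintegral fineK//; apply: integrable_fin_num => //; exact: Kg.
rewrite Fub; apply: eq_integral => y _; rewrite /F /=.
under eq_integral do rewrite EFinM.
rewrite integralZr//; last exact: Kf.
by rewrite EFinM /Rintegral fineK//; apply: integrable_fin_num => //; exact: Kf.
Qed.

End Fubini.

(** * Indefinite integrals and their weak derivatives *)

Section WeakDerivative.
Context {R : realType}.
Local Notation leb := (@lebesgue_measure R).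
Implicit Types (f g phi : R -> R).

(** Local absolute continuity in integral form. It constrains [f] at every point and [g] only up to
    a null set; half-open intervals concatenate without overlap. *)
Definition primitive f g := locally_integrable setT g /\
  forall a b, a <= b -> f b - f a = \int[leb]_(x in `]a, b]) g x.

Lemma test_function_support phi : test_function phi ->
  exists2 M : R, 0 < M & forall x, M < `|x| -> phi x = 0 /\ derive1 phi x = 0.
Proof.
(* The given bound may be negative, hence the absolute value. Beyond it [phi] vanishes in a
   neighbourhood, so its derivative vanishes too. *)
move=> [dphi cphi [M MP]]; exists (`|M| + 1).
  by rewrite (lt_le_trans ltr01)// lerDr.
move=> x Mx; have Mx' : M < `|x|.
  by rewrite (le_lt_trans _ Mx)// (le_trans (ler_norm _))// lerDl.
split; first exact: MP.
rewrite derive1E (@near_eq_derive _ _ _ _ (cst 0)) ?derive_cst//.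
have : `|y| @[y --> x] --> `|x| by apply: cvg_norm; exact: cvg_id.
move=> /cvgr_gt/(_ _ Mx'); apply: filterS => y; exact: MP.
Qed.

Lemma test_function_continuous phi : test_function phi -> continuous phi.
Proof.
by move=> [dphi _ _] x; apply/differentiable_continuous/derivable1_diffP.
Qed.

Lemma test_function_Rintegral phi (a b : R) : test_function phi -> a <= b ->
  \int[leb]_(x in `]a, b]) derive1 phi x = phi b - phi a.
Proof.
move=> tphi; have contphi := test_function_continuous tphi.
move: tphi => [dphi cphi _]; rewrite le_eqVlt => /predU1P[->|ab].
  by rewrite set_itv_ge ?bnd_simp ?ltxx// Rintegral_set0 subrr.
have cphi1 : {within `[a, b], continuous (derive1 phi)}.
  exact: continuous_subspaceT.
rewrite Rintegral_itv_obnd_cbnd; last first.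
  by apply: locally_integrable_itvoc; exact: continuous_locally_integrable.
rewrite /Rintegral (continuous_FTC2 (F := phi) ab cphi1)//.
split => //.
  by apply: cvg_at_right_filter; exact: contphi.
by apply: cvg_at_left_filter; exact: contphi.
Qed.

Lemma Rintegral_supported f (A : set R) : (forall x, ~ A x -> f x = 0) ->
  \int[leb]_x f x = \int[leb]_(x in A) f x.
Proof.
move=> f0; rewrite [RHS]Rintegral_mkcond; apply: eq_Rintegral => x _.
by rewrite patchE; case: ifPn => // /negP; rewrite inE => /f0.
Qed.

Lemma Rintegral_itvoc_cat g (a b c : R) : locally_integrable setT g ->
  a <= b -> b <= c ->
  \int[leb]_(x in `]a, c]) g x =
  \int[leb]_(x in `]a, b]) g x + \int[leb]_(x in `]b, c]) g x.
Proof.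
move=> lg ab bc; rewrite -(@Rintegral_itvB R g (BRight a) (BRight c) b)//.
- by rewrite addrC subrK.
- exact: locally_integrable_itvoc.
Qed.

Lemma primitive_exists g : locally_integrable setT g -> exists f, primitive f g.
Proof.
move=> lg; exists (fun x => if 0 <= x then \int[leb]_(t in `]0, x]) g t
                    else - \int[leb]_(t in `]x, 0]) g t).
split => // a b ab.
have [a0|a0] := leP 0 a; have [b0|b0] := leP 0 b.
- by rewrite (Rintegral_itvoc_cat lg a0 ab) addrC addKr.
- lra.
- by rewrite opprK (Rintegral_itvoc_cat lg (ltW a0) b0) addrC.
- by rewrite (Rintegral_itvoc_cat lg ab (ltW b0)); ring.
Qed.

(** Absolute continuity of the integral, applied to [g] cut off to a window around x because [g] is
    only locally integrable. *)
Lemma primitive_continuous f g : primitive f g -> continuous f.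
Proof.
move=> [lg fg] x; pose J := `]x - 1, x + 1]%classic.
have ig : leb.-integrable setT (EFin \o (g \_ J)).
  rewrite -restrict_EFin; apply/(integrable_mkcond _ _).1 => //.
    exact: measurable_itv.
  exact: locally_integrable_itvoc.
apply/cvgrPdist_lt => e e0.
have [d [d0 dP]] := integral_normr_continuous ig e0.
have H u v : J u -> J v -> u <= v -> v - u < d -> `|f v - f u| < e.
  rewrite /J /= !in_itv/= => /andP[u1 u2] /andP[v1 v2] uv uvd.
  rewrite fg// (le_lt_trans (le_normr_Rintegral _ _))//.
    exact: locally_integrable_itvoc.
  rewrite [ltLHS](_ : _ = \int[leb]_(t in `]u, v]) `|(g \_ J) t|); last first.
    apply: eq_Rintegral => t; rewrite inE/= in_itv/= => /andP[ut tv].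
    rewrite patchE ifT// inE /J/= in_itv/=; apply/andP; split; lra.
  apply: dP; first exact: measurable_itv.
  have /= -> := @lebesgue_measure_itv R `]u, v].
  by rewrite lte_fin; case: ifPn => // _; rewrite -EFinD lte_fin.
have xJ : J x by rewrite /J /= in_itv/=; apply/andP; split; lra.
near=> y; have yx : `|x - y| < Num.min d 1.
  by near: y; apply: cvgr_dist_lt => //; rewrite lt_min d0 ltr01.
move: yx; rewrite lt_min => /andP[yxd yx1].
have yJ : J y.
  move: yx1; rewrite ltr_norml => /andP[? ?].
  by rewrite /J /= in_itv/=; apply/andP; split; lra.
have [xy|yx] := leP x y.
  by rewrite distrC H// (le_lt_trans (ler_norm _))// distrC.
by rewrite H// ?ltW// (le_lt_trans (ler_norm _)).
Unshelve. all: by end_near. Qed.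

Lemma near_eq_addr_derive1 F f (c x : R) : derivable F x 1 ->
  (\forall y \near x, F y + c = f y) ->
  derivable f x 1 /\ derive1 f x = derive1 F x.
Proof.
move=> dF Ff; have Ff' : \forall y \near x, (F \+ cst c) y = f y by [].
have dc : derivable (cst c : R -> R) x 1 by exact: derivable_cst.
split; first by apply: (near_eq_derivable Ff'); exact: derivableD.
by rewrite !derive1E -(near_eq_derive _ Ff') deriveD// derive_cst addr0.
Qed.

Lemma primitive_is_derive f g (x : R) : primitive f g -> continuous g ->
  derivable f x 1 /\ derive1 f x = g x.
Proof.
move=> [lg fg] cg; pose F y := \int[leb]_(t in `]x - 1, y]) g t.
have [] := @continuous_FTC1 R g (BRight (x - 1)) x (x + 1) _ _ _ (cg x).
- by rewrite ltrDl.
- exact: locally_integrable_itvoc.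
- by rewrite lte_fin; lra.
rewrite -/F => dF F'.
have fF : \forall y \near x, F y + f (x - 1) = f y.
  near=> y; have xy : x - 1 <= y by near: y; apply: lt_le_nbhsr; lra.
  by rewrite /F -fg// subrK.
by have [? ->] := near_eq_addr_derive1 dF fF.
Unshelve. all: by end_near. Qed.

(** Integration by parts through Fubini: f(x) - f(-T) is the integral of 1_{y <= x} g(y), and after
    the exchange the integral of phi' from y to T is -phi(y). *)
Lemma primitive_weak_derivative f g : primitive f g -> is_weak_derivative f g.
Proof.
move=> prim; have cf := primitive_continuous prim.
move: prim => [lg fg]; split => //; first exact: continuous_locally_integrable.
move=> phi tphi; have [M M0 MP] := test_function_support tphi.
have [dphi cphi _] := tphi; pose T := M + 1; pose I := `](- T), T]%classic.
have mI : measurable (I : set (measurableTypeR R)) by exact: measurable_itv.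
have lphi' := continuous_locally_integrable cphi.
have IM x : ~ I x -> phi x = 0 /\ derive1 phi x = 0.
  move=> Ix; apply: MP; rewrite ltNge ler_norml; apply/negP => /andP[xM Mx].
  by apply: Ix; rewrite /I /= in_itv/= /T; apply/andP; split; lra.
pose K (z : R * R) : R := (z.2 <= z.1)%R%:R.
have mK : measurable_fun setT K.
  apply: (measurableT_comp (f := fun b : bool => b%:R : R)) => //.
  exact: measurable_fun_ler.
have K1 z : `|K z| <= 1 by rewrite /K; case: (z.2 <= z.1); rewrite ?normr1 ?normr0.
pose gT := g \_ I; pose pT := derive1 phi \_ I.
have igT : leb.-integrable setT (EFin \o gT).
  rewrite /gT -restrict_EFin; apply/(integrable_mkcond _ _).1 => //.
  exact: locally_integrable_itvoc.
have ipT : leb.-integrable setT (EFin \o pT).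
  rewrite /pT -restrict_EFin; apply/(integrable_mkcond _ _).1 => //.
  exact: locally_integrable_itvoc.
have TT : - T <= T by rewrite /T; lra.
have phiT : phi T = 0.
  by have [] := MP T _; rewrite // ger0_norm /T; lra.
have phiNT : phi (- T) = 0.
  by have [] := MP (- T) _; rewrite // normrN ger0_norm /T; lra.
rewrite (@Rintegral_supported _ I); last by move=> x /IM[_ ->]; rewrite mulr0.
rewrite [in RHS](@Rintegral_supported _ I); last first.
  by move=> x /IM[-> _]; rewrite mulr0.
(* The constant f(-T) contributes f(-T) (phi(T) - phi(-T)) = 0. *)
have -> : \int[leb]_(x in I) (f x * derive1 phi x) =
    \int[leb]_(x in I) (f (- T) * derive1 phi x) +
    \int[leb]_(x in I) ((f x - f (- T)) * derive1 phi x).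
  rewrite -RintegralD//; first by apply: eq_Rintegral => x _; ring.
  - apply: locally_integrable_itvoc; apply: continuous_locally_integrable.
    by move=> x; apply: cvgM; [exact: cvg_cst|exact: cphi].
  - apply: locally_integrable_itvoc; apply: continuous_locally_integrable.
    by move=> x; apply: cvgM; [apply: cvgB; [exact: cf|exact: cvg_cst]|exact: cphi].
rewrite RintegralZl//; last exact: locally_integrable_itvoc.
rewrite test_function_Rintegral// phiT phiNT subrr mulr0 add0r.
transitivity (\int[leb]_x (pT x * \int[leb]_y (K (x, y) * gT y))).
  rewrite Rintegral_mkcond; apply: eq_Rintegral => x _.
  rewrite /pT !patchE; case: ifPn => [|_]; rewrite ?mul0r// inE => Ix.
  rewrite mulrC; congr (_ * _).
  move: (Ix); rewrite /I /= in_itv/= => /andP[Tx xT].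
  rewrite fg ?ltW// Rintegral_mkcond; apply: eq_Rintegral => y _.
  rewrite /gT !patchE /K /= !mem_setE/= /I /= !in_itv/=.
  have [yx|yx] := leP y x; last by rewrite andbF mul0r.
  by rewrite mul1r andbT (le_trans yx xT) andbT.
rewrite Rintegral_Fubini_kernel// -mulN1r -RintegralZl//; last first.
  apply: locally_integrable_itvoc; apply: locally_integrable_continuousM => //.
  exact: test_function_continuous.
rewrite [RHS]Rintegral_mkcond; apply: eq_Rintegral => y _.
rewrite /gT !patchE; case: ifPn => [|_]; rewrite ?mulr0// inE => Iy.
rewrite mulrCA mulrC; congr (_ * _).
move: (Iy); rewrite /I /= in_itv/= => /andP[Ty yT].
transitivity (\int[leb]_(x in `[y, T]) derive1 phi x).
  rewrite [RHS]Rintegral_mkcond; apply: eq_Rintegral => x _.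
  rewrite /pT !patchE /K /= !mem_setE/= /I /= !in_itv/=.
  have [yx|yx] := leP y x; last by rewrite mulr0.
  by rewrite mulr1 (lt_le_trans Ty yx).
rewrite -Rintegral_itv_obnd_cbnd; last exact: locally_integrable_itvoc.
by rewrite test_function_Rintegral// phiT sub0r mulN1r.
Qed.

End WeakDerivative.

(** * Weakly differentiable continuous functions are indefinite integrals *)

Section WeakDerivativePrimitive.
Context {R : realType}.
Local Notation leb := (@lebesgue_measure R).
Implicit Types (f g phi : R -> R).

(** A primitive of [h] is nondecreasing with no increment over ]a, b], so it is constant there and
    its derivative [h] vanishes. *)
Lemma continuous_Rintegral_eq0 (h : R -> R) (a b : R) : continuous h ->
  (forall x, 0 <= h x) -> \int[leb]_(x in `]a, b]) h x = 0 ->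
  forall x, a < x < b -> h x = 0.
Proof.
move=> ch h0 ih x /andP[ax xb].
have lh := continuous_locally_integrable ch.
have [H pH] := primitive_exists lh.
have [lH HE] := pH.
have ndH u v : u <= v -> H u <= H v.
  by move=> uv; rewrite -subr_ge0 HE//; apply: Rintegral_ge0.
have HC : \forall y \near x, cst (H a) y = H y.
  near=> y.
  have ay : a <= y by near: y; apply: lt_le_nbhsr.
  have yb : y <= b by near: y; apply: lt_le_nbhsl.
  apply/eqP; rewrite /cst eq_le ndH// (le_trans (ndH _ _ yb))//.
  by rewrite -subr_le0 HE ?ih// (le_trans ay yb).
have [_ <-] := primitive_is_derive x pH ch.
by rewrite derive1E -(near_eq_derive _ HC) derive_cst.
Unshelve. all: by end_near. Qed.

(** The du Bois-Reymond lemma: k = f - G, with [G] a primitive of [g], is orthogonal to the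
    derivatives of all test functions, and has to be constant. As test functions are only C^1, any
    continuous compactly supported function of integral zero is such a derivative, in particular one
    built from [k] itself. *)
Lemma weak_derivative_primitive f g : continuous f -> is_weak_derivative f g ->
  primitive f g.
Proof.
move=> cf [_ lg wd].
have [G pG] := primitive_exists lg.
have cG := primitive_continuous pG.
have [_ _ wdG] := primitive_weak_derivative pG.
pose k x := f x - G x.
have ck : continuous k by move=> x; apply: cvgB; [exact: cf|exact: cG].
have kphi phi : test_function phi -> \int[leb]_x (k x * derive1 phi x) = 0.
  move=> tphi; have [M M0 MP] := test_function_support tphi.
  have [_ cphi _] := tphi.
  pose J := `](- (M + 1)), (M + 1)]%classic.
  have lphi (h : R -> R) : continuous h ->
      leb.-integrable J (EFin \o (fun x => h x * derive1 phi x)).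
    move=> ch; apply: locally_integrable_itvoc.
    apply: continuous_locally_integrable => x.
    by apply: cvgM; [exact: ch|exact: cphi].
  have JE (h : R -> R) : \int[leb]_x (h x * derive1 phi x) =
      \int[leb]_(x in J) (h x * derive1 phi x).
    apply: Rintegral_supported => x Jx; have [|_ ->] := MP x; last by rewrite mulr0.
    rewrite ltNge ler_norml; apply/negP => /andP[xM Mx].
    by apply: Jx; rewrite /J /= in_itv/=; apply/andP; split; lra.
  rewrite JE; under eq_Rintegral do rewrite mulrBl.
  rewrite RintegralB; [|exact: measurable_itv|exact: lphi|exact: lphi].
  by rewrite -!JE wd// wdG// subrr.
suff kc a b : a <= b -> k a = k b.
  split => // a b ab; have [_ <-//] := pG.
  by have := kc _ _ ab; rewrite /k; lra.
move=> ab; pose T := `|a| + `|b| + 1.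
have T0 : 0 < T by rewrite /T; have := normr_ge0 a; have := normr_ge0 b; lra.
have aT : - T < a < T.
  by rewrite -ltr_norml /T; have := normr_ge0 b; lra.
have bT : - T < b < T.
  by rewrite -ltr_norml /T; have := normr_ge0 a; lra.
pose chi (x : R) : R := Num.max 0 (T - `|x|).
have cchi : continuous chi.
  move=> x; rewrite /chi; apply: (@continuous_max _ _ (cst 0) (fun x => T - `|x|)).
    exact: cvg_cst.
  by apply: cvgB; [exact: cvg_cst|exact: cvg_norm].
have chi0 x : 0 <= chi x by rewrite /chi le_max lexx.
have chiT x : T <= `|x| -> chi x = 0.
  by move=> Tx; rewrite /chi; apply/max_idPl; rewrite subr_le0.
have chi_gt0 x : - T < x < T -> 0 < chi x.
  by rewrite -ltr_norml => xT; rewrite /chi lt_max subr_gt0 xT orbT.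
pose I := `](- T), T]%classic.
have ci h : continuous h -> leb.-integrable I (EFin \o h).
  by move=> ch; apply: locally_integrable_itvoc; exact: continuous_locally_integrable.
(* The mean of [k] with weight [chi], chosen so that [psi] below has integral zero. *)
pose c := (\int[leb]_(x in I) (chi x * k x)) / \int[leb]_(x in I) chi x.
have ichi : \int[leb]_(x in I) chi x != 0.
  apply/eqP => /(continuous_Rintegral_eq0 cchi chi0)/(_ _ aT) => chia.
  by have := chi_gt0 _ aT; rewrite chia ltxx.
pose psi x := chi x * (k x - c).
have cchik : continuous (fun x => chi x * k x).
  by move=> x; apply: cvgM; [exact: cchi|exact: ck].
have cchic : continuous (fun x => chi x * c).
  by move=> x; apply: cvgM; [exact: cchi|exact: cvg_cst].
have cpsi : continuous psi.
  move=> x; apply: cvgM; first exact: cchi.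
  by apply: cvgB; [exact: ck|exact: cvg_cst].
have ipsi : \int[leb]_(x in I) psi x = 0.
  rewrite /psi; under eq_Rintegral do rewrite mulrBr.
  rewrite RintegralB; [|exact: measurable_itv|exact: ci|exact: ci].
  rewrite RintegralZr; [|exact: measurable_itv|exact: ci].
  by rewrite /c mulrC divfK// subrr.
have lpsi := continuous_locally_integrable cpsi.
have [phi pphi] := primitive_exists lpsi.
have [_ phiE] := pphi.
have psi0 x : T <= `|x| -> psi x = 0 by move=> Tx; rewrite /psi chiT// mul0r.
have phiT x : T < `|x| -> phi x = phi (- T).
  have psi_out (A : set R) : (forall t, A t -> T <= `|t|) ->
      \int[leb]_(t in A) psi t = 0.
    move=> AT; rewrite -[RHS](@Rintegral_set0 _ _ _ leb psi) Rintegral_mkcond.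
    rewrite [RHS]Rintegral_mkcond; apply: eq_Rintegral => t _.
    by rewrite !patchE; case: ifPn; rewrite ?in_set0// inE => /AT /psi0.
  rewrite ltr_normr => /orP[xT|xT].
    have TT : - T <= T by lra.
    apply/eqP; rewrite -subr_eq0 phiE; last by lra.
    rewrite (Rintegral_itvoc_cat lpsi TT (ltW xT)) ipsi add0r; apply/eqP.
    apply: psi_out => t; rewrite /= in_itv/= => /andP[tT _].
    by rewrite ler_normr (ltW tT).
  apply/eqP; rewrite eq_sym -subr_eq0 phiE; last by lra.
  apply/eqP; apply: psi_out => t; rewrite /= in_itv/= => /andP[_ tT].
  by rewrite ler_normr lerNr tT orbT.
(* [phi] is equal to phi(-T) on both sides of [-T, T], so subtracting this constant gives compact
   support. *)
pose phi0 x := phi x - phi (- T).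
have pphi0 : primitive phi0 psi.
  by split => // u v uv; rewrite -phiE// /phi0; ring.
have dphi0 : derive1 phi0 = psi.
  by apply/funext => x; have [] := primitive_is_derive x pphi0 cpsi.
have tphi : test_function phi0.
  split.
  - by move=> x; have [] := primitive_is_derive x pphi0 cpsi.
  - by rewrite dphi0.
  - by exists T => x Tx; rewrite /phi0 phiT// subrr.
have := kphi _ tphi; rewrite dphi0 (@Rintegral_supported _ _ I); last first.
  move=> x Ix; rewrite psi0 ?mulr0// leNgt ltr_norml; apply/negP => /andP[? ?].
  by apply: Ix; rewrite /I /= in_itv/=; apply/andP; split; lra.
move=> kpsi.
have ckpsi : continuous (fun x => k x * psi x).
  by move=> x; apply: cvgM; [exact: ck|exact: cpsi].
have ccpsi : continuous (fun x => c * psi x).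
  by move=> x; apply: cvgM; [exact: cvg_cst|exact: cpsi].
(* chi (k - c)^2 = k psi - c psi, and both terms integrate to zero; hence [k] equals [c] wherever
   [chi] is positive. *)
have sq0 : \int[leb]_(x in I) (chi x * (k x - c) ^+ 2) = 0.
  transitivity (\int[leb]_(x in I) (k x * psi x - c * psi x)).
    by apply: eq_Rintegral => x _; rewrite /psi; ring.
  rewrite RintegralB; [|exact: measurable_itv|exact: ci|exact: ci].
  rewrite RintegralZl ?ipsi ?mulr0 ?kpsi ?subrr//; first exact: measurable_itv.
  exact: ci.
have csq : continuous (fun x => chi x * (k x - c) ^+ 2).
  move=> x; apply: cvgM; first exact: cchi.
  by rewrite expr2; apply: cvgM; apply: cvgB;
    [exact: ck|exact: cvg_cst|exact: ck|exact: cvg_cst].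
have sq_ge0 x : 0 <= chi x * (k x - c) ^+ 2 by rewrite mulr_ge0// sqr_ge0.
have kE x : - T < x < T -> k x = c.
  move=> xT; have /eqP := continuous_Rintegral_eq0 csq sq_ge0 sq0 xT.
  by rewrite mulf_eq0 gt_eqF ?chi_gt0//= sqrf_eq0 subr_eq0 => /eqP.
by rewrite !kE.
Qed.

Lemma is_weak_derivative_wderiv f : weakly_differentiable f ->
  is_weak_derivative f (wderiv f).
Proof.
move=> [g fg]; rewrite /wderiv.
by apply: (@xgetPex _ _ [set g | is_weak_derivative f g]); exists g.
Qed.

Lemma wderiv_primitive f : continuous f -> weakly_differentiable f ->
  primitive f (wderiv f).
Proof.
by move=> cf /is_weak_derivative_wderiv; exact: weak_derivative_primitive.
Qed.

Lemma primitive_weakly_differentiable f g : primitive f g ->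
  weakly_differentiable f.
Proof. by move=> /primitive_weak_derivative; exists g. Qed.

(** Lebesgue differentiation on each half-line starting at -k, followed by a countable intersection
    over k. *)
Lemma primitive_ae_derive f g : primitive f g ->
  {ae leb, forall x, derivable f x 1 /\ derive1 f x = g x}.
Proof.
move=> [lg fg].
have H k : {ae leb, forall x, - k%:R < x -> derivable f x 1 /\ derive1 f x = g x}.
  have := @FTC1 R g (BRight (- k%:R : R)) _ lg.
  move=> /(_ (fun y => locally_integrable_itvoc _ _ lg)).
  apply: ae_imply => x + kx; rewrite lte_fin => /(_ kx).
  set F := fun y : R => _; move=> [dF F'].
  have fF : \forall y \near x, F y + f (- k%:R) = f y.
    near=> y; have ky : - k%:R <= y by near: y; apply: lt_le_nbhsr.
    by rewrite /F -fg// subrK.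
  by have [? ->] := near_eq_addr_derive1 dF fF.
have := ae_foralln H; apply: ae_imply => x Hx.
have [k kx] : exists k : nat, - k%:R < x.
  exists (Num.bound `|x|); rewrite ltrNl (le_lt_trans (ler_norm _))// normrN.
  by rewrite archi_boundP.
exact: Hx kx.
Unshelve. all: by end_near. Qed.

(** The chosen weak derivative and [g] both coincide almost everywhere with the classical derivative
    of [f]. *)
Lemma wderiv_ae f g : primitive f g -> {ae leb, forall x, wderiv f x = g x}.
Proof.
move=> pg; have pw := wderiv_primitive (primitive_continuous pg)
  (primitive_weakly_differentiable pg).
apply: ae_imply2 (primitive_ae_derive pw) (primitive_ae_derive pg).
by move=> x [_ <-] [_ <-].
Qed.

Lemma primitiveB f1 g1 f2 g2 : primitive f1 g1 -> primitive f2 g2 ->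
  primitive (f1 \- f2) (g1 \- g2).
Proof.
move=> [l1 H1] [l2 H2]; split; first exact: locally_integrableB.
move=> a b ab /=; rewrite RintegralB//; try exact: locally_integrable_itvoc.
by rewrite -H1// -H2//; ring.
Qed.

End WeakDerivativePrimitive.

(** * The characteristic y as generalized inverse of x + F(x) *)

Section GeneralizedInverse.
Context {R : realType}.
Local Notation leb := (@lebesgue_measure R).
Variable d : eulerian R.
Local Notation mu := (e_mu d).
Local Notation F := (e_F d).
Local Notation M := (e_Finfty d).
Local Notation y := (L_y d).

Lemma e_mu_fin (A : set (measurableTypeR R)) : measurable A ->
  mu A = (fine (mu A))%:E.
Proof. by move=> mA; rewrite fineK// fin_num_measure. Qed.

Lemma e_FE (x : R) : (F x)%:E = mu `]-oo, x]%classic.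
Proof. by rewrite [RHS]e_mu_fin. Qed.

Lemma e_FinftyE : M%:E = mu setT.
Proof. by rewrite [RHS]e_mu_fin. Qed.

Lemma e_F_ge0 (x : R) : 0 <= F x.
Proof. by rewrite -lee_fin e_FE. Qed.

Lemma e_F_le (x : R) : F x <= M.
Proof. by rewrite -lee_fin e_FE e_FinftyE le_measure ?inE. Qed.

Lemma e_Finfty_ge0 : 0 <= M.
Proof. exact: le_trans (e_F_ge0 0) (e_F_le 0). Qed.

Lemma e_F_nd (a b : R) : a <= b -> F a <= F b.
Proof.
move=> ab; rewrite -lee_fin !e_FE le_measure ?inE//.
by apply: subset_itvl; rewrite bnd_simp.
Qed.

Lemma e_mu_itvoc (a b : R) : a <= b -> mu `]a, b]%classic = (F b - F a)%:E.
Proof.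
move=> ab.
have : mu `]-oo, b]%classic = (mu `]-oo, a]%classic + mu `]a, b]%classic)%E.
  rewrite -measureU//; last first.
    apply/seteqP; split=> // x [/=].
    by rewrite !in_itv/= => xa /andP[]; rewrite ltNge xa.
  by rewrite -itv_bndbnd_setU ?bnd_simp.
by rewrite -!e_FE EFinB => ->; rewrite [X in (_ = X - _)%E]addeC addeK.
Qed.

(** Continuity from above of a finite measure along the half-lines ending at x + 1/(n+1). *)
Lemma e_F_right (x e : R) : 0 < e ->
  exists2 del : R, 0 < del & F (x + del) < F x + e.
Proof.
move=> e0; pose A n := `]-oo, (x + n.+1%:R^-1)]%classic : set (measurableTypeR R).
have AE : \bigcap_n A n = `]-oo, x]%classic.
  apply/seteqP; split => [z Az|z /= zx n _]; last first.
    by rewrite /A /= !in_itv/= in zx *; rewrite (le_trans zx)// lerDl.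
  rewrite /= in_itv/= leNgt; apply/negP => xz.
  have [n xn] := ltr_add_invr xz.
  by have := Az n I; rewrite /A /= in_itv/= leNgt xn.
have mA n : measurable (A n) by exact: measurable_itv.
have : mu (A n) @[n --> \oo] --> mu (\bigcap_n A n).
  apply: nonincreasing_cvg_mu => //.
  - by rewrite ltey_eq fin_num_measure.
  - by rewrite AE.
  - move=> m n mn; apply/subsetPset; apply: subset_itvl; rewrite bnd_simp.
    by rewrite lerD2l lef_pV2 ?posrE// ler_nat.
rewrite AE -e_FE => /fine_cvgP[_ /cvgrPdist_lt/(_ e e0)[n _ /(_ n (leqnn n))]] /= H.
exists n.+1%:R^-1 => //.
have := ler_norm (- (F x - F (x + n.+1%:R^-1))); rewrite normrN.
by move=> /le_lt_trans/(_ H); rewrite /= /e_F; lra.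
Qed.

(** The Galois connection from which all properties of y follow. The definition of y uses open
    half-lines, whereas [F] uses closed ones; right continuity of [F] reconciles them. *)
Lemma L_y_le (xi x : R) : (y xi <= x) = (xi <= x + F x).
Proof.
rewrite /L_y; set S := [set z : R | _].
have SE z : S z <-> (mu `]-oo, z[%classic < (xi - z)%:E)%E.
  by rewrite /S/=; split; rewrite EFinB lteBrDr.
have S_lt z : S z -> forall t, t < z -> t + F t < xi.
  rewrite SE => Sz t tz; rewrite -ltrBrDl -lte_fin e_FE.
  apply: (@le_lt_trans _ _ (xi - z)%:E); last by rewrite lte_fin; lra.
  apply: le_trans (ltW Sz); rewrite le_measure ?inE//.
  by apply: subset_itvl; rewrite bnd_simp.
have S_in z : z + F z < xi -> S z.
  rewrite -ltrBrDl -lte_fin e_FE => zx; apply/SE; apply: le_lt_trans zx.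
  by rewrite le_measure ?inE//; apply: subset_itvl; rewrite bnd_simp.
have Sub : ubound S xi.
  move=> z; rewrite SE => /(le_lt_trans (measure_ge0 mu _)).
  by rewrite lte_fin subr_gt0 => /ltW.
have S0 : S !=set0.
  exists (xi - M - 1); apply: S_in.
  by have := e_F_le (xi - M - 1); lra.
have Ssup : has_sup S by split => //; exists xi.
apply/idP/idP => [Sx|xix].
  rewrite leNgt; apply/negP => xi_gt.
  (* Half of the gap is left for the increase of [F], the other half for the displacement of x. *)
  have e0 : 0 < (xi - (x + F x)) / 2 by lra.
  have [del del0 Fdel] := e_F_right x e0.
  pose del' := Num.min del ((xi - (x + F x)) / 2).
  have del'0 : 0 < del' by rewrite lt_min del0.
  have : S (x + del').
    apply: S_in; have : F (x + del') <= F (x + del).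
      by apply: e_F_nd; rewrite lerD2l ge_min lexx.
    have : del' <= (xi - (x + F x)) / 2 by rewrite ge_min lexx orbT.
    by lra.
  move=> /(ub_le_sup (proj2 Ssup)); lra.
apply: ge_sup => // z Sz; rewrite leNgt; apply/negP => /(S_lt _ Sz).
by rewrite ltNge xix.
Qed.

Lemma L_y_gt (xi x : R) : (x < y xi) = (x + F x < xi).
Proof. by rewrite ltNge L_y_le -ltNge. Qed.

Lemma L_y_nd (a b : R) : a <= b -> y a <= y b.
Proof. by move=> ab; rewrite L_y_le (le_trans ab)// -L_y_le. Qed.

(** As a <= y(a) + F(y(a)) and [F] is nondecreasing, moving y(a) to the right by b - a raises x +
    F(x) at least to b. *)
Lemma L_y_lip (a b : R) : a <= b -> y b <= y a + (b - a).
Proof.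
move=> ab; rewrite L_y_le.
have : a <= y a + F (y a) by rewrite -L_y_le.
have : F (y a) <= F (y a + (b - a)) by apply: e_F_nd; lra.
lra.
Qed.

Lemma L_y_lex (xi : R) : y xi <= xi.
Proof. by rewrite L_y_le lerDl e_F_ge0. Qed.

Lemma L_y_ge (xi : R) : xi - M <= y xi.
Proof.
rewrite leNgt; apply/negP => yxi; have : xi <= y xi + F (y xi) by rewrite -L_y_le.
by have := e_F_le (y xi); lra.
Qed.

Lemma L_yK (x : R) : y (x + F x) = x.
Proof.
apply/eqP; rewrite eq_le L_y_le lexx/= leNgt; apply/negP => H.
have : x + F x <= y (x + F x) + F (y (x + F x)) by rewrite -L_y_le.
by have := e_F_nd (ltW H); lra.
Qed.

Lemma L_y_continuous : continuous y.
Proof.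
move=> x; apply/cvgrPdist_lt => e e0; near=> z.
have zx : `|x - z| < e by near: z; apply: cvgr_dist_lt.
apply: le_lt_trans zx; have [xz|/ltW zx] := leP x z.
  have := L_y_nd xz; have := L_y_lip xz => H1 H2.
  by rewrite distrC [leRHS]distrC !ger0_norm; lra.
have := L_y_nd zx; have := L_y_lip zx => H1 H2.
by rewrite !ger0_norm; lra.
Unshelve. all: by end_near. Qed.

Lemma measurable_L_y : measurable_fun setT y.
Proof. exact: continuous_measurable_fun L_y_continuous. Qed.

Lemma preimage_L_y_itvoc (a b : R) :
  y @^-1` `]a, b] = `]a + F a, b + F b]%classic.
Proof.
by apply/seteqP; split => x /=; rewrite !in_itv/= L_y_gt L_y_le.
Qed.

Let L_y_mixin := isMeasurableFun.Build _ _ (measurableTypeR R)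
  (measurableTypeR R) y measurable_L_y.
Let L_y_mfun : {mfun measurableTypeR R >-> measurableTypeR R} :=
  HB.pack y L_y_mixin.

(** The preimage of ]a, b] is ]a + F(a), b + F(b)], of length (b - a) + mu(]a, b]). Half-open
    intervals are stable under intersection and determine the measure. *)
Lemma leb_preimage_L_y (A : set (measurableTypeR R)) : measurable A ->
  leb (y @^-1` A) = (leb A + mu A)%E.
Proof.
move=> mA; have -> : (leb A + mu A)%E = measure_add leb mu A.
  by rewrite measure_addE.
rewrite -[LHS]/(pushforward leb L_y_mfun A).
apply: (@measure_unique _ R (measurableTypeR R) (@ocitv R)
  (fun n => `](- n%:R), n%:R]%classic)) => //.
- exact: ocitvI.
- by move=> i; exact: is_ocitv.
- apply/seteqP; split => // x _; exists (Num.bound `|x|) => //=.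
  rewrite in_itv/=; have := archi_boundP (normr_ge0 x).
  by rewrite ltr_norml => /andP[-> /ltW].
- move=> _ [[a b] _ <-].
  rewrite -[RHS]/(measure_add leb mu _) measure_addE /=.
  have [ab|ba] := leP a b; last first.
    rewrite set_itv_ge ?bnd_simp -?leNgt ?ltW//.
    rewrite /pushforward preimage_set0 !measure0.
    by symmetry; exact: adde0.
  rewrite [LHS](_ : _ = leb `](a + F a), (b + F b)]%classic); last first.
    by rewrite /pushforward -preimage_L_y_itvoc.
  have /= -> := @lebesgue_measure_itv R `]a, b].
  have /= -> := @lebesgue_measure_itv R `](a + F a), (b + F b)].
  rewrite e_mu_itvoc// !lte_fin; have Fab := e_F_nd ab.
  move: ab; rewrite le_eqVlt => /predU1P[->|ab]; first by rewrite !ltxx subrr adde0.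
  by rewrite ab ltr_leD// -!EFinD; congr EFin; ring.
- move=> k; rewrite [X in (X < _)%E](_ : _ =
    leb `](- k%:R + F (- k%:R)), (k%:R + F k%:R)]%classic); last first.
    by rewrite /pushforward -preimage_L_y_itvoc.
  have /= -> := @lebesgue_measure_itv R `](- k%:R + F (- k%:R)), (k%:R + F k%:R)].
  by case: ifP => // _; rewrite -EFinD ltry.
Qed.

Lemma ge0_integral_L_y (f : R -> \bar R) : measurable_fun setT f ->
  (forall x, 0 <= f x)%E ->
  (\int[leb]_xi f (y xi) = \int[leb]_x f x + \int[mu]_x f x)%E.
Proof.
move=> mf f0; rewrite -ge0_integral_measure_add//.
transitivity (\int[pushforward leb L_y_mfun]_x f x)%E; last first.
  apply: eq_measure_integral => A mA _.
  by rewrite -[RHS]/(measure_add leb mu A) measure_addE -leb_preimage_L_y.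
by rewrite ge0_integral_pushforward ?preimage_setT.
Qed.

End GeneralizedInverse.

(** * Integration against a measure with a density *)

Section Density.
Context {R : realType}.
Local Notation leb := (@lebesgue_measure R).
Import HBNNSimple.

(** True for indicators by definition, hence for simple functions, and then by monotone convergence
    along an approximating sequence. *)
Lemma ge0_integral_density
    (m : {measure set (measurableTypeR R) -> \bar R}) (g f : R -> R) :
  measurable_fun setT g -> (forall x, 0 <= g x) -> has_density m g ->
  measurable_fun setT f -> (forall x, 0 <= f x) ->
  (\int[m]_x (f x)%:E = \int[leb]_x (f x * g x)%:E)%E.
Proof.
move=> mg g0 mdens mf f0.
have mf' : measurable_fun [set: measurableTypeR R] (EFin \o f).
  exact/measurable_EFinP.
pose h := nnsfun_approx measurableT mf'.
have hf x : (h n x)%:E @[n --> \oo] --> (f x)%:E.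
  by apply: cvg_nnsfun_approx => // t _; rewrite lee_fin.
have hnd x : {homo (fun n => (h n x)%:E) : a b / (a <= b)%N >-> (a <= b)%E}.
  by move=> a b ab; rewrite lee_fin; exact/lefP/nd_nnsfun_approx.
have gE k A : 0 <= k -> measurable A ->
    (\int[leb]_x (k * \1_A x * g x)%:E = k%:E * m A)%E.
  move=> k0 mA; rewrite mdens// [in RHS]integral_mkcond -ge0_integralZl//.
  - apply: eq_integral => x _; rewrite patchE indicE.
    by case: (x \in A); rewrite ?mulr1 ?mulr0 ?mul0r ?mule0.
  - by apply/(measurable_restrictT _ _).1 => //; exact/measurable_EFinP/measurable_funTS.
  - by move=> x _; apply: erestrict_ge0 => t _; rewrite lee_fin.
have hE n : (\int[m]_x (h n x)%:E = \int[leb]_x (h n x * g x)%:E)%E.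
  rewrite integralT_nnsfun sintegralE fsbig_finite//=.
  under [RHS]eq_integral => x _.
    rewrite (fimfunE (h n) x) fsbig_finite//= mulr_suml -sumEFin; over.
  rewrite ge0_integral_sum//.
  - apply: eq_bigr => k _; have [k0|k0] := leP 0 k; first by rewrite gE.
    rewrite preimage_nnfun0// measure0 mule0 integral0_eq// => x _.
    by rewrite indicE in_set0 mulr0 mul0r.
  - move=> k; apply/measurable_EFinP; apply: measurable_funM => //.
    exact: measurable_funM.
  - move=> k x _; rewrite lee_fin mulr_ge0//.
    by have := nnfun_muleindic_ge0 (h n) k x; rewrite -EFinM lee_fin.
transitivity (limn (fun n => \int[m]_x (h n x)%:E)%E).
  rewrite -monotone_convergence//.
  - by apply: eq_integral => x _; apply/esym/cvg_lim.
  - by move=> n; exact/measurable_EFinP.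
  - by move=> n x _; rewrite lee_fin.
under eq_fun do rewrite hE.
rewrite -monotone_convergence//.
- apply: eq_integral => x _; apply/cvg_lim => //.
  rewrite EFinM; under eq_fun do rewrite EFinM.
  exact: cvgeZr.
- by move=> n; apply/measurable_EFinP; exact: measurable_funM.
- by move=> n x _; rewrite lee_fin mulr_ge0.
- by move=> x _ a b ab; rewrite lee_fin ler_wpM2r// -lee_fin; exact: hnd.
Qed.

End Density.

(** * Change of variables from Lagrangian to Eulerian integrals *)

Section ChangeOfVariables.
Context {R : realType}.
Local Notation leb := (@lebesgue_measure R).
Variable d : eulerian R.
Local Notation mu := (e_mu d).
Local Notation y := (L_y d).

(** A Lebesgue-null set off which mu is the energy density times dx, phrased with integrals because
    it is used to rewrite integrands. *)
Definition singular_part_carrier (N : set (measurableTypeR R)) :=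
  [/\ measurable N, leb N = 0%E & forall f : R -> R, measurable_fun setT f ->
    (forall x, 0 <= f x) -> (\int[mu]_(x in ~` N) (f x)%:E =
     \int[leb]_x (f x * (e_ux d x ^+ 2 + e_rhobar d x ^+ 2))%:E)%E].

Lemma L2_measurable (f : R -> R) : L2 f -> measurable_fun setT f.
Proof. by rewrite /L2 inE => /andP[]; rewrite inE. Qed.

Hypothesis Hd : in_D d.

Lemma measurable_e_ux : measurable_fun setT (e_ux d).
Proof. by case: Hd => -[_ _ _ /L2_measurable]. Qed.

Lemma measurable_e_rhobar : measurable_fun setT (e_rhobar d).
Proof. by case: Hd => _ /L2_measurable. Qed.

(** The null set comes from mutual singularity: the singular part vanishes off it and the absolutely
    continuous part vanishes on it. *)
Lemma exists_singular_part_carrier : exists N, singular_part_carrier N.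
Proof.
case: Hd => _ _ [mac [[acl [ms [[N [mN N0 msN]] muE]]] dens]].
exists N; split => // f mf f0.
set g := fun x => _ + _ in dens.
have mg : measurable_fun setT g.
  by apply: measurable_funD; apply: measurable_funX;
    [exact: measurable_e_ux|exact: measurable_e_rhobar].
have g0 x : 0 <= g x by rewrite addr_ge0 ?sqr_ge0.
have mNC : measurable (~` N) by exact: measurableC.
transitivity (\int[measure_add mac ms]_(x in ~` N) (f x)%:E)%E.
  apply: eq_measure_integral => A mA _.
  by rewrite -[RHS]/(measure_add mac ms A) measure_addE muE.
rewrite ge0_integral_measure_add//; last 2 first.
- by move=> x _; rewrite lee_fin.
- by apply/measurable_EFinP; exact: measurable_funTS.
rewrite [X in (_ + X)%E](_ : _ = 0)%E ?adde0; last first.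
  apply: null_set_integral => //.
  by apply/measurable_EFinP; exact: measurable_funTS.
rewrite -(ge0_integral_density mg g0 dens mf f0).
have macN : mac N = 0%E.
  rewrite dens//; apply: null_set_integral => //.
  by apply/measurable_EFinP; exact: measurable_funTS.
rewrite [RHS](ge0_negligible_integral mN)//.
- by rewrite setTD.
- exact/measurable_EFinP.
- by move=> x _; rewrite lee_fin.
Qed.

Lemma e_density_ge1 x : 1 <= e_density d x.
Proof. by rewrite /e_density -addrA lerDl addr_ge0 ?sqr_ge0. Qed.

Lemma e_density_gt0 x : 0 < e_density d x.
Proof. exact: lt_le_trans ltr01 (e_density_ge1 x). Qed.

Lemma measurable_e_density : measurable_fun setT (e_density d).
Proof.
apply: measurable_funD.
  apply: measurable_funD => //; apply: measurable_funX; exact: measurable_e_ux.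
by apply: measurable_funX; exact: measurable_e_rhobar.
Qed.

Variable N : set (measurableTypeR R).
Hypothesis HN : singular_part_carrier N.

(* The density of dx with respect to dx + mu: y_xi = L_weight \o y a.e. *)
Definition L_weight x : R := \1_(~` N) x / e_density d x.
Local Notation w := L_weight.

Let mN : measurable N. Proof. by case: HN. Qed.
Let mNC : measurable (~` N). Proof. exact: measurableC. Qed.

Lemma L_weight_ge0 x : 0 <= w x.
Proof. by rewrite divr_ge0// ltW// e_density_gt0. Qed.

Lemma L_weight_le1 x : w x <= 1.
Proof.
rewrite /L_weight ler_pdivrMr ?e_density_gt0// mul1r indicE.
by rewrite (le_trans _ (e_density_ge1 x))// lern1; case: (_ \in _).
Qed.

Lemma measurable_L_weight : measurable_fun setT w.
Proof.
apply: measurable_funM; first exact: measurable_indic.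
have -> : (fun x => (e_density d x)^-1) = (fun x => e_density d x `^ (-1)).
  by apply/funext => x; rewrite powR_inv1// ltW// e_density_gt0.
apply: (measurableT_comp (f := fun x : R => x `^ (-1))) => //.
exact: measurable_e_density.
Qed.

(** Off [N], w = 1/D with D = 1 + u_x^2 + rhobar^2, and both sides equal (D - 1)/D^2; on [N] both
    sides are zero. *)
Lemma L_weight_sphere x : w x * (1 - w x) =
  (e_ux d x * w x) ^+ 2 + (e_rhobar d x * w x) ^+ 2.
Proof.
have D0 : e_density d x != 0 by rewrite gt_eqF// e_density_gt0.
rewrite /L_weight indicE; case: (_ \in _); rewrite /= ?mul0r ?mulr0 ?expr0n/= ?addr0//.
rewrite mul1r; set D := e_density d x in D0 *.
have -> : D^-1 * (1 - D^-1) = (D - 1) * D^-1 ^+ 2 by field.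
rewrite !exprMn -mulrDl; congr (_ * _); rewrite /D /e_density; ring.
Qed.

(** The left side is the integral of f w against dx + mu. The weight kills [N], and off [N] this
    measure is D dx, with w D = 1. *)
Lemma ge0_integral_L_weight (f : R -> R) : measurable_fun setT f ->
  (forall x, 0 <= f x) ->
  (\int[leb]_xi (f (y xi) * w (y xi))%:E = \int[leb]_x (f x)%:E)%E.
Proof.
move=> mf f0; have [_ N0 muN] := HN.
have mw := measurable_L_weight.
have mfw : measurable_fun setT (fun x => f x * w x) by exact: measurable_funM.
have fw0 x : 0 <= f x * w x by rewrite mulr_ge0// L_weight_ge0.
rewrite (@ge0_integral_L_y _ d (fun x => (f x * w x)%:E)); last 2 first.
- exact/measurable_EFinP.
- by move=> x; rewrite lee_fin.
pose g x := e_ux d x ^+ 2 + e_rhobar d x ^+ 2.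
have mg : measurable_fun setT g.
  by apply: measurable_funD; apply: measurable_funX;
    [exact: measurable_e_ux|exact: measurable_e_rhobar].
have g0 x : 0 <= g x by rewrite addr_ge0 ?sqr_ge0.
have -> : (\int[mu]_x (f x * w x)%:E = \int[leb]_x (f x * w x * g x)%:E)%E.
  rewrite -muN// [RHS]integral_mkcond; apply: eq_integral => x _.
  rewrite patchE /L_weight indicE; case: (x \in ~` N) => //.
  by rewrite mul0r mulr0.
rewrite -ge0_integralD//; last 4 first.
- by move=> x _; rewrite lee_fin.
- exact/measurable_EFinP.
- by move=> x _; rewrite lee_fin mulr_ge0.
- by apply/measurable_EFinP; exact: measurable_funM.
transitivity (\int[leb]_(x in ~` N) (f x)%:E)%E; last first.
  rewrite -setTD -ge0_negligible_integral//.
  - exact/measurable_EFinP.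
  - by move=> x _; rewrite lee_fin.
rewrite [RHS]integral_mkcond; apply: eq_integral => x _.
rewrite patchE /L_weight indicE; case: (x \in ~` N) => /=; last first.
  by rewrite !mul0r !mulr0 mul0r adde0.
have D0 : e_density d x != 0 by rewrite gt_eqF// e_density_gt0.
rewrite -EFinD; congr EFin; rewrite mul1r.
rewrite -[X in X + _]mulr1 -mulrDr -mulrA.
rewrite -[in X in _ * (_ * X)](_ : e_density d x = 1 + g x).
  by rewrite mulVf// mulr1.
by rewrite /g addrA.
Qed.

(** A level set of y has positive measure exactly when mu has an atom at [c]. Off [N] the measure mu
    has a density, so such an atom lies in [N], where the weight is zero. *)
Lemma L_weight_level_negligible (c : R) :
  {ae leb, forall xi, y xi = c -> w (y xi) = 0}.
Proof.
have mc : measurable ([set c] `&` ~` N : set (measurableTypeR R)).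
  by apply: measurableI.
exists (y @^-1` ([set c] `&` ~` N)); split.
- rewrite -[X in measurable X]setTI.
  exact: (measurable_L_y d).
- rewrite leb_preimage_L_y//.
  have -> : leb ([set c] `&` ~` N) = 0%E.
    apply/eqP; rewrite -measure_le0 -(lebesgue_measure_set1 c).
    by rewrite le_measure ?inE//; exact: subIsetl.
  rewrite add0e; have [_ _ muN] := HN.
  transitivity (\int[mu]_(x in ~` N) (\1_[set c] x : R)%:E)%E.
    by rewrite integral_indic.
  rewrite muN//; transitivity (\int[leb]_(x in [set c])
      (e_ux d x ^+ 2 + e_rhobar d x ^+ 2)%:E)%E; last exact: integral_set1.
  rewrite [RHS]integral_mkcond; apply: eq_integral => x _.
  by rewrite patchE indicE; case: (_ \in _); rewrite ?mul1r ?mul0r.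
- move=> xi /= /not_implyP[yxi wy]; split => //.
  apply: contrapT => nN; apply: wy.
  by rewrite /L_weight indicE memNset// mul0r.
Qed.

(** The two indicators can differ only on the level sets of y through [a] and [b], where the weight
    vanishes almost everywhere. *)
Lemma preimage_L_y_itvoc_weight (a b : R) : a <= b ->
  {ae leb, forall xi, \1_(`]a, b]) xi * w (y xi) =
                      \1_(`]y a, y b]) (y xi) * w (y xi)}.
Proof.
move=> ab; apply: ae_imply2 (L_weight_level_negligible (y a))
  (L_weight_level_negligible (y b)) => xi Ha Hb.
have [/Ha ->|ya] := eqVneq (y xi) (y a); first by rewrite !mulr0.
have [/Hb ->|yb] := eqVneq (y xi) (y b); first by rewrite !mulr0.
congr (_ * _); rewrite !indicE; congr (_%:R); congr nat_of_bool.
apply/idP/idP; rewrite !inE/= !in_itv/= => /andP[axi xib].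
  by rewrite lt_neqAle eq_sym ya !L_y_nd// ltW.
apply/andP; split; first by rewrite ltNge; apply: contraTN axi => /(L_y_nd d); rewrite -leNgt.
by apply: contraTT xib; rewrite -!ltNge => /ltW/(L_y_nd d); rewrite lt_neqAle eq_sym yb.
Qed.

Lemma ge0_integral_L_weight_itv (f : R -> R) (a b : R) : a <= b ->
  measurable_fun setT f -> (forall x, 0 <= f x) ->
  (\int[leb]_(xi in `]a, b]) (f (y xi) * w (y xi))%:E =
   \int[leb]_(x in `]y a, y b]) (f x)%:E)%E.
Proof.
move=> ab mf f0; have mw := measurable_L_weight; have my := measurable_L_y d.
have mfy : measurable_fun setT (f \o y) by exact: measurableT_comp.
have mwy : measurable_fun setT (w \o y) by exact: measurableT_comp.
have mI (u v : R) : measurable_fun setT (\1_(`]u, v]) : R -> R).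
  exact: measurable_indic.
pose F x := f x * \1_(`]y a, y b]) x.
have mF : measurable_fun setT F by exact: measurable_funM.
have F0 x : 0 <= F x by rewrite mulr_ge0.
transitivity (\int[leb]_x (F x)%:E)%E; last first.
  rewrite [RHS]integral_mkcond; apply: eq_integral => x _.
  by rewrite patchE /F indicE; case: (_ \in _); rewrite ?mulr1 ?mulr0.
rewrite -ge0_integral_L_weight// integral_mkcond.
transitivity (\int[leb]_xi (f (y xi) * (\1_(`]a, b]) xi * w (y xi)))%:E)%E.
  apply: eq_integral => x _.
  by rewrite patchE indicE; case: (_ \in _); rewrite ?mul1r ?mul0r ?mulr0.
apply: ge0_ae_eq_integral => //.
- apply/measurable_EFinP; apply: measurable_funM => //; exact: measurable_funM.
- apply/measurable_EFinP; apply: measurable_funM => //.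
  exact: (measurableT_comp mF).
- by move=> x _; rewrite lee_fin mulr_ge0// mulr_ge0 ?L_weight_ge0// indicE ler0n.
- by move=> x _; rewrite lee_fin mulr_ge0 ?L_weight_ge0.
- apply: ae_imply (preimage_L_y_itvoc_weight ab) => xi H _.
  by rewrite H /F mulrA.
Qed.

Lemma integral_L_weight_itv (f : R -> R) (a b : R) : a <= b ->
  measurable_fun setT f ->
  (\int[leb]_(xi in `]a, b]) (f (y xi) * w (y xi))%:E =
   \int[leb]_(x in `]y a, y b]) (f x)%:E)%E.
Proof.
move=> ab mf; rewrite integralE [RHS]integralE; congr (_ - _)%E.
- transitivity (\int[leb]_(xi in `]a, b]) (f^\+ (y xi) * w (y xi))%:E)%E.
    apply: eq_integral => x _; rewrite funeposE /funrpos -EFin_max.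
    by rewrite maxr_pMl ?L_weight_ge0// mul0r.
  rewrite ge0_integral_L_weight_itv//; last exact: measurable_funrpos.
  by apply: eq_integral => x _; rewrite funeposE /funrpos EFin_max.
- transitivity (\int[leb]_(xi in `]a, b]) (f^\- (y xi) * w (y xi))%:E)%E.
    apply: eq_integral => x _; rewrite funenegE /funrneg -EFinN -EFin_max.
    by rewrite maxr_pMl ?L_weight_ge0// mul0r mulNr.
  rewrite ge0_integral_L_weight_itv//; last exact: measurable_funrneg.
  by apply: eq_integral => x _; rewrite funenegE /funrneg EFin_max EFinN.
Qed.

Lemma Rintegral_L_weight_itv (f : R -> R) (a b : R) : a <= b ->
  measurable_fun setT f ->
  \int[leb]_(xi in `]a, b]) (f (y xi) * w (y xi)) =
  \int[leb]_(x in `]y a, y b]) f x.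
Proof. by move=> ab mf; rewrite /Rintegral integral_L_weight_itv. Qed.

(** The complementary weight recovers mu: almost everywhere 1 - w = w (u_x^2 + rhobar^2), so (1 - w)
    dx = w mu, which adds up with (1 - w) mu to mu. *)
Lemma ge0_integral_onem_L_weight (f : R -> R) : measurable_fun setT f ->
  (forall x, 0 <= f x) ->
  (\int[leb]_xi (f (y xi) * (1 - w (y xi)))%:E = \int[mu]_x (f x)%:E)%E.
Proof.
move=> mf f0; have [_ N0 muN] := HN; have mw := measurable_L_weight.
have w1 x : 0 <= 1 - w x by rewrite subr_ge0 L_weight_le1.
have mfw : measurable_fun setT (fun x => f x * w x) by exact: measurable_funM.
have mfw1 : measurable_fun setT (fun x => f x * (1 - w x)).
  by apply: measurable_funM => //; exact: measurable_funB.
have fw0 x : 0 <= f x * w x by rewrite mulr_ge0// L_weight_ge0.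
have fw10 x : 0 <= f x * (1 - w x) by rewrite mulr_ge0.
pose g x := e_ux d x ^+ 2 + e_rhobar d x ^+ 2.
have mg : measurable_fun setT g.
  by apply: measurable_funD; apply: measurable_funX;
    [exact: measurable_e_ux|exact: measurable_e_rhobar].
rewrite (@ge0_integral_L_y _ d (fun x => (f x * (1 - w x))%:E)); last 2 first.
- exact/measurable_EFinP.
- by move=> x; rewrite lee_fin.
have -> : (\int[leb]_x (f x * (1 - w x))%:E = \int[mu]_x (f x * w x)%:E)%E.
  transitivity (\int[leb]_x (f x * w x * g x)%:E)%E; last first.
    rewrite -muN// [LHS]integral_mkcond; apply: eq_integral => x _.
    rewrite patchE /L_weight indicE; case: (x \in ~` N) => //.
    by rewrite mul0r mulr0.
  apply: ge0_ae_eq_integral => //.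
  - exact/measurable_EFinP.
  - by apply/measurable_EFinP; exact: measurable_funM.
  - by move=> x _; rewrite lee_fin.
  - by move=> x _; rewrite lee_fin mulr_ge0// addr_ge0 ?sqr_ge0.
  - exists N; split => // x /= /not_implyP[_ H]; apply: contrapT => nNx; apply: H.
    rewrite /L_weight indicE mem_set//=.
    have D0 : e_density d x != 0 by rewrite gt_eqF// e_density_gt0.
    congr EFin; rewrite -mulrA; congr (_ * _).
    have gE : g x = e_density d x - 1 by rewrite /g /e_density; ring.
    by rewrite gE mul1r mulrBr mulVf// mulr1.
rewrite -ge0_integralD//.
- by apply: eq_integral => x _; rewrite -EFinD; congr EFin; ring.
- by move=> x _; rewrite lee_fin.
- exact/measurable_EFinP.
- by move=> x _; rewrite lee_fin.
- exact/measurable_EFinP.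
Qed.

Lemma integral_energy_le :
  (\int[leb]_x (e_ux d x ^+ 2 + e_rhobar d x ^+ 2)%:E <= (e_Finfty d)%:E)%E.
Proof.
have [_ _ /(_ (cst 1))] := HN.
have -> : (\int[leb]_x (cst 1 x * (e_ux d x ^+ 2 + e_rhobar d x ^+ 2))%:E =
    \int[leb]_x (e_ux d x ^+ 2 + e_rhobar d x ^+ 2)%:E)%E.
  by apply: eq_integral => x _; rewrite /cst mul1r.
move=> <-//; have mNC' : measurable (~` N) by [].
rewrite [leLHS](@integral_cst _ _ _ (e_mu d) (~` N) mNC' 1%E) mul1e e_FinftyE.
by rewrite le_measure ?inE.
Qed.

End ChangeOfVariables.

(** * Borel representatives of the Lagrangian derivatives *)

Section Profile.
Context {R : realType}.
Local Notation leb := (@lebesgue_measure R).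

(* [A], [B], [h] are everywhere defined Borel representatives of U_xi, rbar   *)
(* and h for the tuple L d.                                                   *)
Record L_profile (d : eulerian R) (A B h : R -> R) : Prop := {
  prof_measA : measurable_fun setT A;
  prof_measB : measurable_fun setT B;
  prof_meash : measurable_fun setT h;
  prof_h_ge0 : forall xi, 0 <= h xi;
  prof_h_le1 : forall xi, h xi <= 1;
  prof_sphere : forall xi, h xi = h xi ^+ 2 + A xi ^+ 2 + B xi ^+ 2;
  prof_y : primitive (L_y d) (fun xi => 1 - h xi);
  prof_U : primitive (e_u d \o L_y d) A;
  prof_B : forall a b, a <= b -> \int[leb]_(xi in `]a, b]) B xi =
    \int[leb]_(x in `]L_y d a, L_y d b]) e_rhobar d x;
  prof_rbar : {ae leb, forall xi,
    e_rhobar d (L_y d xi) * wderiv (L_y d) xi = B xi};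
  prof_H : forall xi,
    (\int[leb]_(eta in `]-oo, xi]) (h eta)%:E = (xi - L_y d xi)%:E)%E;
  prof_HT : (\int[leb]_xi (h xi)%:E = (e_Finfty d)%:E)%E
}.

(** The representatives are u_x w, rhobar w and 1 - w composed with y; each field is then an
    instance of the change of variables. *)
Lemma L_profile_exists (d : eulerian R) : in_D d -> exists A B h, L_profile d A B h.
Proof.
move=> Hd; have [N HN] := exists_singular_part_carrier Hd.
pose w := L_weight d N; pose y := L_y d.
have mw : measurable_fun setT w by exact: measurable_L_weight.
have my : measurable_fun setT y := measurable_L_y d.
have mwy : measurable_fun setT (w \o y) by exact: measurableT_comp.
have w0 x : 0 <= w x by exact: L_weight_ge0.
have w1 x : w x <= 1 by exact: L_weight_le1.
have mux := measurable_e_ux Hd; have mrho := measurable_e_rhobar Hd.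
have cu : continuous (e_u d) by case: Hd => -[].
have pu : primitive (e_u d) (e_ux d).
  by case: Hd => -[_ _ wd _] _ _; exact: wderiv_primitive.
pose A xi := e_ux d (y xi) * w (y xi).
pose B xi := e_rhobar d (y xi) * w (y xi).
pose h xi := 1 - w (y xi).
have mA : measurable_fun setT A.
  by apply: measurable_funM => //; exact: (measurableT_comp mux).
have mB : measurable_fun setT B.
  by apply: measurable_funM => //; exact: (measurableT_comp mrho).
have mh : measurable_fun setT h by exact: measurable_funB.
have sphere xi : h xi = h xi ^+ 2 + A xi ^+ 2 + B xi ^+ 2.
  have := L_weight_sphere d N (y xi); rewrite -/w /h /A /B => H.
  by rewrite -addrA -H; ring.
have h0 xi : 0 <= h xi by rewrite subr_ge0.
have h1 xi : h xi <= 1 by rewrite gerBl.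
have A1 xi : `|A xi| <= 1.
  have := sphere xi; have := sqr_ge0 (h xi); have := sqr_ge0 (B xi).
  have := h1 xi.
  rewrite ler_norml => *; apply/andP; split; nra.
have py : primitive y (fun xi => 1 - h xi).
  have -> : (fun xi => 1 - h xi) = w \o y by apply/funext => xi; rewrite /h /=; ring.
  split.
    apply: (@bounded_locally_integrable _ _ 1) => // xi /=.
    by rewrite ger0_norm ?w0 ?w1.
  move=> a b ab; have := Rintegral_L_weight_itv Hd HN ab (measurable_cst (1 : R)).
  rewrite Rintegral_cst// mul1r; under eq_Rintegral do rewrite mul1r.
  move=> ->; have /= -> := @lebesgue_measure_itv R `](y a), (y b)].
  have : y a <= y b by exact: L_y_nd.
  rewrite le_eqVlt lte_fin => /predU1P[yab|->]; last by [].
  by rewrite -/y yab ltxx subrr.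
have pU : primitive (e_u d \o y) A.
  split; first exact: bounded_locally_integrable A1.
  move=> a b ab /=; rewrite Rintegral_L_weight_itv//.
  by have [_ ->//] := pu; exact: L_y_nd.
have HE (f : R -> R) : measurable_fun setT f -> (forall x, 0 <= f x) ->
    (\int[leb]_xi (f (y xi) * h xi)%:E = \int[e_mu d]_x (f x)%:E)%E.
  exact: ge0_integral_onem_L_weight.
exists A, B, h; split => //.
- by move=> a b ab; rewrite Rintegral_L_weight_itv.
- apply: ae_imply (wderiv_ae py) => xi ->.
  by rewrite /B /h; congr (_ * _); ring.
(* [xi'] is the right end of the level set of y through [xi]. Up to [xi'] the integral of [h] is
   exactly F(x); between [xi] and [xi'] the map y is constant, and that piece is subtracted. *)
- move=> xi; pose x := y xi; pose xi' := x + e_F d x.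
  have xile : xi <= xi' by rewrite -L_y_le.
  have y' : y xi' = x by exact: L_yK.
  have mx : measurable_fun setT (\1_(`]-oo, x]) : R -> R) by exact: measurable_indic.
  have Hx : (\int[leb]_(eta in `]-oo, xi']) (h eta)%:E = (e_F d x)%:E)%E.
    rewrite e_FE; have := HE _ mx (fun=> ler0n _ _).
    rewrite integral_indic// setIT => <-.
    rewrite integral_mkcond; apply: eq_integral => t _.
    rewrite patchE indicE !mem_setE /= !in_itv/= L_y_le -/xi'.
    by case: ifP; rewrite ?mul1r ?mul0r.
  have hI : (\int[leb]_(eta in `]xi, xi']) (h eta)%:E = (xi' - xi - (x - y xi))%:E)%E.
    have lh : locally_integrable setT h.
      by apply: (@bounded_locally_integrable _ _ 1) => // t; rewrite ger0_norm.
    have [lg gE] := py.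
    have -> : xi' - xi - (x - y xi) = \int[leb]_(eta in `]xi, xi']) h eta.
      have := gE _ _ xile; rewrite RintegralB//; last 2 first.
      - by apply: locally_integrable_itvoc; 
        apply: continuous_locally_integrable => t; exact: cvg_cst.
      - exact: locally_integrable_itvoc.
      rewrite Rintegral_cst// mul1r; have /= -> := @lebesgue_measure_itv R `]xi, xi'].
      move: xile; rewrite y' lte_fin le_eqVlt => /predU1P[->|->] /=; last by lra.
      by rewrite ltxx /=; lra.
    rewrite /Rintegral fineK//; apply: integrable_fin_num => //.
    exact: locally_integrable_itvoc.
  have : (\int[leb]_(eta in `]-oo, xi']) (h eta)%:E =
      \int[leb]_(eta in `]-oo, xi]) (h eta)%:E +
      \int[leb]_(eta in `]xi, xi']) (h eta)%:E)%E.
    rewrite -ge0_integral_setU//.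
    - by rewrite -itv_bndbnd_setU ?bnd_simp.
    - by apply/measurable_EFinP; exact: measurable_funS mh.
    - by move=> t _; rewrite lee_fin.
    - apply/disj_setPS => t [/=]; rewrite !in_itv/= => tx /andP[].
      by rewrite ltNge tx.
  rewrite Hx hI => HH.
  transitivity ((e_F d x)%:E - (xi' - xi - (x - y xi))%:E)%E.
    by rewrite HH addeK.
  by rewrite -EFinB; congr EFin; rewrite -/y /xi' /x; ring.
- have := HE (cst 1) (measurable_cst _) (fun=> ler01).
  rewrite [X in _ = X](@integral_cst _ _ _ (e_mu d) setT measurableT 1%E) mul1e.
  rewrite -[X in _ = X -> _]/(e_mu d (setT : set (measurableTypeR R))) -e_FinftyE => <-.
  by apply: eq_integral => xi _; rewrite /cst mul1r.
Qed.

End Profile.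

(** * Moving averages of bounded functions *)

Section Averages.
Context {R : realType}.
Local Notation leb := (@lebesgue_measure R).
Implicit Types (f g : R -> R).

Lemma derivable_cvg_backward f (x l : R) : derivable f x 1 -> derive1 f x = l ->
  n.+1%:R * (f x - f (x - n.+1%:R^-1)) @[n --> \oo] --> l.
Proof.
move=> df <-; rewrite derive1E.
have {df} : (fun h => h^-1 *: ((f \o shift x) (h *: 1) - f x)) @ 0^' --> 'D_1 f x by [].
move=> /cvgr_dnbhsP/(_ (fun n => - n.+1%:R^-1)) H.
have {}H := H _; apply: cvg_trans (H _); last first.
  split; first by move=> n; rewrite oppr_eq0 invr_eq0.
  by rewrite -oppr0; apply: cvgN; exact: cvg_harmonic.
apply: near_eq_cvg; near=> n.
rewrite /= invrN invrK [_%:A]mulr1 [- _ + x]addrC /GRing.scale /= mulNr -mulrN opprB//.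
Unshelve. all: by end_near. Qed.

Lemma bounded_integrable_itv f (a b M : R) : measurable_fun setT f ->
  (forall x, `|f x| <= M) -> leb.-integrable `]a, b] (EFin \o f).
Proof.
by move=> mf fM; apply: locally_integrable_itvoc; exact: bounded_locally_integrable fM.
Qed.

(** The mean over the backward window of length 1/(k+1); the shifted index keeps the window defined
    for k = 0. *)
Definition Steklov_average g k x :=
  k.+1%:R * \int[leb]_(z in `](x - k.+1%:R^-1), x]) g z.

Lemma Steklov_averageE G g k x : primitive G g ->
  Steklov_average g k x = k.+1%:R * (G x - G (x - k.+1%:R^-1)).
Proof.
by move=> [_ GE]; rewrite /Steklov_average GE// lerBlDr lerDl invr_ge0.
Qed.

Lemma measurable_Steklov_average g k : locally_integrable setT g ->
  measurable_fun setT (Steklov_average g k).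
Proof.
move=> lg; have [G pG] := primitive_exists lg.
have cG := primitive_continuous pG.
have -> : Steklov_average g k = fun x => k.+1%:R * (G x - G (x - k.+1%:R^-1)).
  by apply/funext => x; exact: Steklov_averageE.
apply: continuous_measurable_fun => x; apply: cvgM; first exact: cvg_cst.
apply: cvgB; first exact: cG.
apply: (cvg_comp (fun x : R => x - k.+1%:R^-1) G _ (cG (x - k.+1%:R^-1))).
by apply: cvgB; [exact: cvg_id|exact: cvg_cst].
Qed.

Lemma normr_Rintegral_itv_le g (a b M : R) : measurable_fun setT g ->
  (forall x, `|g x| <= M) -> a <= b ->
  `|\int[leb]_(x in `]a, b]) g x| <= M * (b - a).
Proof.
move=> mg gM ab; have lg := bounded_locally_integrable mg gM.
have M0 : 0 <= M := le_trans (normr_ge0 _) (gM 0).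
apply: le_trans (le_normr_Rintegral _ _) _ => //.
  exact: locally_integrable_itvoc.
apply: (@le_trans _ _ (\int[leb]_(x in `]a, b]) M)).
  apply: le_Rintegral => //.
  - by apply: integrable_norm; exact: locally_integrable_itvoc.
  - by apply: (@bounded_integrable_itv _ _ _ M) => // ?; rewrite ger0_norm.
rewrite Rintegral_cst//; have /= -> := @lebesgue_measure_itv R `]a, b].
rewrite lte_fin; case: ifPn => [_|_]; first by rewrite -EFinD.
by rewrite mulr0 mulr_ge0// subr_ge0.
Qed.

Lemma Steklov_average_le1 g k x : measurable_fun setT g ->
  (forall x, `|g x| <= 1) -> `|Steklov_average g k x| <= 1.
Proof.
move=> mg g1; rewrite normrM ger0_norm// -ler_pdivlMl// mulr1.
apply: le_trans (normr_Rintegral_itv_le mg g1 _) _.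
  by rewrite lerBlDr lerDl invr_ge0.
by rewrite mul1r opprB addrC subrK.
Qed.

(** The averages are backward difference quotients of a primitive, so they converge almost
    everywhere; being bounded by 1, they converge in L^1 on bounded intervals. *)
Lemma Steklov_average_cvg g (a b : R) : measurable_fun setT g ->
  (forall x, `|g x| <= 1) ->
  \int[leb]_(x in `]a, b]) `|g x - Steklov_average g k x|
    @[k --> \oo] --> (0 : R).
Proof.
move=> mg g1; have lg := bounded_locally_integrable mg g1.
have [G pG] := primitive_exists lg.
pose gk := Steklov_average g.
have mgk k : measurable_fun setT (gk k) by exact: measurable_Steklov_average.
have gk1 k x : `|gk k x| <= 1 by exact: Steklov_average_le1.
have [] := @dominated_convergence _ _ _ leb `]a, b]%classic (measurable_itv _)
  (fun k => EFin \o gk k) (EFin \o g) (EFin \o cst 1).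
- by move=> k; apply/measurable_EFinP; exact: measurable_funTS (mgk k).
- by apply/measurable_EFinP; exact: measurable_funTS mg.
- apply: ae_imply (primitive_ae_derive pG) => x [dG G'] _.
  apply/fine_cvgP; split; first by near=> n.
  rewrite [X in X @ _](_ : _ =
      fun k => k.+1%:R * (G x - G (x - k.+1%:R^-1))); last first.
    by apply/funext => k; exact: Steklov_averageE.
  exact: derivable_cvg_backward.
- by apply: (@bounded_integrable_itv _ _ _ 1) => // ?; rewrite normr1.
- by apply: aeW => x k _; rewrite /= lee_fin.
move=> _ + _; rewrite -[X in _ --> X -> _]/((0 : R)%:E) => /fine_cvg.
apply: cvg_trans; apply: near_eq_cvg; near=> k.
by rewrite /Rintegral /=; congr fine; apply: eq_integral => x _ /=; rewrite distrC.
Unshelve. all: by end_near. Qed.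

End Averages.

(** * From convergence on intervals to weak convergence *)

Section WeakConvergence.
Context {R : realType}.
Local Notation leb := (@lebesgue_measure R).
Implicit Types (f g : R -> R).

Lemma bounded_convergence_itv (a b M : R) (fn : nat -> R -> R) f :
  (forall n, measurable_fun setT (fn n)) -> measurable_fun setT f ->
  (forall n x, `|fn n x| <= M) -> (forall x, fn n x @[n --> \oo] --> f x) ->
  \int[leb]_(x in `]a, b]) fn n x @[n --> \oo] --> \int[leb]_(x in `]a, b]) f x.
Proof.
move=> mfn mf fnM fnf.
have [] := @dominated_convergence _ _ _ leb `]a, b]%classic (measurable_itv _)
  (fun n => EFin \o fn n) (EFin \o f) (EFin \o cst M).
- by move=> n; apply/measurable_EFinP; exact: measurable_funTS (mfn n).
- by apply/measurable_EFinP; exact: measurable_funTS mf.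
- apply: aeW => x _; apply/fine_cvgP; split; first by near=> n.
  exact: fnf.
- by apply: (@bounded_integrable_itv _ _ _ _ `|M|) => // ?; rewrite lexx.
- by apply: aeW => x n _; rewrite /= lee_fin.
move=> intf _ H; apply: fine_cvg; rewrite /Rintegral fineK//.
exact: integrable_fin_num.
Unshelve. all: by end_near. Qed.

(** Replace [g] by a moving average, close to it in L^1. By Fubini the average moves onto v_n,
    giving integrals of v_n over windows of fixed length; these tend to zero pointwise and are
    bounded, so dominated convergence concludes. *)
Lemma bounded_weak_cvg (C : R) (vn : nat -> R -> R) g (a b : R) :
  (forall n, measurable_fun setT (vn n)) -> (forall n x, `|vn n x| <= C) ->
  (forall u v, u <= v -> \int[leb]_(x in `]u, v]) vn n x @[n --> \oo] --> (0 : R)) ->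
  measurable_fun setT g -> (forall x, `|g x| <= 1) ->
  \int[leb]_(x in `]a, b]) (vn n x * g x) @[n --> \oo] --> (0 : R).
Proof.
move=> mvn vnC vn0 mg g1.
have C0 : 0 <= C := le_trans (normr_ge0 _) (vnC 0%N 0).
(* Averaging backward spreads the support of the cut-off [g] to the right by at most one window, of
   length at most 1; [J] makes room for it. *)
pose I := `]a, b]%classic; pose J := `]a, b + 1]%classic.
have mI : measurable (I : set (measurableTypeR R)) by exact: measurable_itv.
have mJ : measurable (J : set (measurableTypeR R)) by exact: measurable_itv.
have IJ x : I x -> J x.
  by rewrite /I /J /= !in_itv/= => /andP[-> xb]/=; rewrite (le_trans xb)// lerDl.
pose gI := g \_ I.
have mgI : measurable_fun setT gI.
  by apply/(measurable_restrictT _ _).1 => //; exact: measurable_funTS.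
have gI1 x : `|gI x| <= 1.
  by rewrite /gI patchE; case: ifP => // _; rewrite normr0.
have lgI := bounded_locally_integrable mgI gI1.
have igI : leb.-integrable setT (EFin \o gI).
  rewrite /gI -restrict_EFin; apply/(integrable_mkcond _ _).1 => //.
  exact: bounded_integrable_itv g1.
apply/cvgrPdist_lt => e e0.
(* [C + 1] rather than [C], since [C] may be zero. *)
have eC0 : 0 < e / 2 / (C + 1) by rewrite !divr_gt0//; lra.
have /cvgrPdist_lt/(_ _ eC0)[k _ /(_ k (leqnn k))] :=
  @Steklov_average_cvg R gI a (b + 1) mgI gI1.
set gk := Steklov_average gI k => Heta.
have mgk : measurable_fun setT gk by exact: measurable_Steklov_average.
have gk1 x : `|gk x| <= 1 by exact: Steklov_average_le1.
set delta : R := k.+1%:R^-1; set K1 : R := k.+1%:R.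
have K10 : 0 < K1 by rewrite /K1 ltr0n.
have delta0 : 0 < delta by rewrite invr_gt0.
have delta1 : delta <= 1 by rewrite invf_le1 ?ler1n// ltr0n.
have Kdelta : delta * K1 = 1 by rewrite mulVf// gt_eqF.
pose K (z : R * R) : R := (z.1 - delta < z.2)%R%:R * (z.2 <= z.1)%R%:R.
have mK : measurable_fun setT K.
  apply: measurable_funM.
    apply: (measurableT_comp (f := fun b : bool => b%:R : R)) => //.
    by apply: measurable_fun_ltr => //; exact: measurable_funB.
  apply: (measurableT_comp (f := fun b : bool => b%:R : R)) => //.
  exact: measurable_fun_ler.
have K_le1 z : `|K z| <= 1.
  rewrite /K -natrM normr_nat lern1.
  by case: (z.1 - delta < z.2); case: (z.2 <= z.1).
pose vJ n := vn n \_ J.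
have ivJ n : leb.-integrable setT (EFin \o vJ n).
  rewrite /vJ -restrict_EFin; apply/(integrable_mkcond _ _).1 => //.
  exact: bounded_integrable_itv (vnC n).
have igK : leb.-integrable setT (EFin \o (fun z => K1 * gI z)).
  have -> : EFin \o (fun z => K1 * gI z) = (fun z => K1%:E * (EFin \o gI) z)%E.
    by apply/funext.
  exact: integrableZl.
pose Q n z := \int[leb]_(x in `]z, z + delta]) vn n x.
have E1 n : \int[leb]_(x in J) (vn n x * gk x) =
    \int[leb]_(z in I) (Q n z * (K1 * g z)).
  transitivity (\int[leb]_x (vJ n x * \int[leb]_z (K (x, z) * (K1 * gI z)))).
    rewrite Rintegral_mkcond; apply: eq_Rintegral => x _.
    rewrite /vJ !patchE; case: ifP => _; last by rewrite mul0r.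
    congr (_ * _); rewrite /gk /Steklov_average -/K1 -/delta -RintegralZl//; last first.
      exact: locally_integrable_itvoc.
    rewrite Rintegral_mkcond; apply: eq_Rintegral => z _.
    rewrite patchE mem_setE /= in_itv/= /K /=.
    by case: (_ < z); case: (z <= x); rewrite /= ?mul1r ?mul0r.
  rewrite Rintegral_Fubini_kernel// [RHS]Rintegral_mkcond.
  apply: eq_Rintegral => z _; rewrite /gI !patchE.
  case: ifPn => [|_]; last by rewrite !mulr0.
  rewrite inE /I/= in_itv/= => /andP[az zb]; congr (_ * _).
  (* For fixed z the kernel is the indicator of [z, z + delta[ in x, while [Q] uses ]z, z + delta];
     the endpoints are exchanged here. *)
  rewrite /Q Rintegral_itv_obnd_cbnd; last exact: bounded_integrable_itv (vnC n).
  rewrite -Rintegral_itv_bndo_bndc; last first.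
    apply: integrableS (locally_integrable_itvcc z (z + delta)
      (bounded_locally_integrable (mvn n) (vnC n))) => //.
    exact: subset_itv_co_cc.
  rewrite [RHS]Rintegral_mkcond; apply: eq_Rintegral => x _.
  rewrite /vJ !patchE !mem_setE /= /J /= !in_itv/= /K /= ltrBlDr.
  have [zx|zx] := leP z x; last by rewrite !mulr0.
  rewrite (lt_le_trans az zx) /= mulr1.
  have [xz|xz] := ltP x (z + delta); last by rewrite mulr0.
  by rewrite mulr1 ifT// (le_trans (ltW xz))// lerD.
have Q0 n z : `|Q n z| <= C * delta.
  have := normr_Rintegral_itv_le (mvn n) (vnC n) (_ : z <= z + delta).
  by rewrite addrAC subrr add0r; apply; rewrite lerDl ltW.
have E2 : \int[leb]_(z in I) (Q n z * (K1 * g z)) @[n --> \oo] --> (0 : R).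
  have -> : 0 = \int[leb]_(z in I) (cst 0 z : R).
    by rewrite /cst Rintegral_cst// mul0r.
  apply: (@bounded_convergence_itv a b C) => //.
  - move=> n; apply: measurable_funM; last exact: measurable_funM.
    have [D pD] := primitive_exists (bounded_locally_integrable (mvn n) (vnC n)).
    have cD := primitive_continuous pD; have [_ DE] := pD.
    have -> : Q n = fun z => D (z + delta) - D z.
      by apply/funext => z; rewrite DE// lerDl ltW.
    apply: continuous_measurable_fun => x; apply: cvgB; last exact: cD.
    apply: (cvg_comp (fun x : R => x + delta) D _ (cD (x + delta))).
    by apply: cvgD; [exact: cvg_id|exact: cvg_cst].
  - move=> n z; rewrite !normrM (ger0_norm (ltW K10)).
    have QK : `|Q n z| * K1 <= C.
      by rewrite -(mulr1 C) -Kdelta mulrA ler_wpM2r ?Q0// ltW.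
    have QK0 : 0 <= `|Q n z| * K1 by rewrite mulr_ge0// ltW.
    by rewrite mulrA -(mulr1 C) ler_pM.
  - move=> z; rewrite -(mul0r (K1 * g z)); apply: cvgM; last exact: cvg_cst.
    by apply: vn0; rewrite lerDl ltW.
have e20 : 0 < e / 2 by lra.
have /cvgrPdist_lt/(_ _ e20) := E2.
apply: filterS => n; rewrite -E1 !sub0r !normrN => Hn.
have iJ (f : R -> R) (M : R) : measurable_fun setT f -> (forall x, `|f x| <= M) ->
  leb.-integrable J (EFin \o f) by exact: bounded_integrable_itv.
have mvg : measurable_fun setT (fun x => vn n x * gk x) by exact: measurable_funM.
have mvgg : measurable_fun setT (fun x => vn n x * (gI x - gk x)).
  by apply: measurable_funM => //; exact: measurable_funB.
have mgg : measurable_fun setT (fun x => `|gI x - gk x|).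
  by apply: measurableT_comp => //; exact: measurable_funB.
have gg2 x : `|gI x - gk x| <= 2.
  by rewrite (le_trans (ler_normB _ _))// (le_trans (lerD (gI1 x) (gk1 x))); lra.
have vgC x : `|vn n x * gk x| <= C.
  by rewrite normrM -[leRHS]mulr1 ler_pM.
have vggC x : `|vn n x * (gI x - gk x)| <= C * 2.
  by rewrite normrM ler_pM.
have -> : \int[leb]_(x in I) (vn n x * g x) =
    \int[leb]_(x in J) (vn n x * gk x) +
    \int[leb]_(x in J) (vn n x * (gI x - gk x)).
  rewrite -RintegralD//; [|exact: iJ mvg vgC|exact: iJ mvgg vggC].
  rewrite Rintegral_mkcond [RHS]Rintegral_mkcond; apply: eq_Rintegral => x _.
  rewrite !patchE /gI !patchE; case xI: (x \in I).
    rewrite ifT; first by ring.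
    by apply/mem_set/IJ/set_mem.
  by case: ifP => // _; rewrite -[point]/(0 : R); ring.
rewrite (le_lt_trans (ler_normD _ _))//.
have HB : `|\int[leb]_(x in J) (vn n x * (gI x - gk x))| <=
    C * \int[leb]_(x in J) `|gI x - gk x|.
  rewrite (le_trans (le_normr_Rintegral _ _))//; first exact: iJ mvgg vggC.
  rewrite -RintegralZl//; last first.
    by apply: (iJ _ 2) => // x; rewrite normr_id.
  apply: le_Rintegral => //.
  - by apply: integrable_norm; exact: iJ mvgg vggC.
  - apply: (iJ _ (C * 2)); first exact: measurable_funM.
    by move=> x; rewrite normrM normr_id (ger0_norm C0) ler_wpM2l.
  - by move=> x _; rewrite normrM ler_wpM2r.
have Hpos : 0 <= \int[leb]_(x in J) `|gI x - gk x| by exact: Rintegral_ge0.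
move: Heta; rewrite sub0r normrN ger0_norm// ltr_pdivlMr ?ltr_wpDl// => Heta.
rewrite [ltRHS](splitr e) ltrD// (le_lt_trans HB)// (le_lt_trans _ Heta)//.
by rewrite mulrC ler_wpM2l// lerDl.
Qed.

End WeakConvergence.

(** * L^2 and sup norms, and estimates for H^1 functions *)

Section Norms.
Context {R : realType}.
Local Notation leb := (@lebesgue_measure R).
Implicit Types (f g u : R -> R).

Lemma norm_L2E f : norm_L2 f = ((\int[leb]_x (f x ^+ 2)%:E) `^ 2^-1)%E.
Proof.
rewrite /norm_L2 unlock; congr (_ `^ _)%E; apply: eq_integral => x _ /=.
by rewrite powR_mulrn// real_normK// num_real.
Qed.

Lemma L2P f : measurable_fun setT f ->
  (\int[leb]_x (f x ^+ 2)%:E < +oo)%E -> L2 f.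
Proof.
move=> mf f2; rewrite /L2 inE; apply/andP; split; rewrite inE//=.
rewrite /finite_norm -/(norm_L2 f) norm_L2E.
exact: poweR_lty.
Qed.

Lemma L2_integrable_sqr f : L2 f -> leb.-integrable setT (EFin \o (fun x => f x ^+ 2)).
Proof. exact: Lfun2_integrable_sqr. Qed.

Lemma L2_sqr_lty f : L2 f -> (\int[leb]_x (f x ^+ 2)%:E < +oo)%E.
Proof.
by move=> /L2_integrable_sqr f2; rewrite ltey_eq integrable_fin_num.
Qed.

Lemma ae_eq_integral_sqr f g : measurable_fun setT f -> measurable_fun setT g ->
  {ae leb, forall x, f x = g x} ->
  (\int[leb]_x (f x ^+ 2)%:E = \int[leb]_x (g x ^+ 2)%:E)%E.
Proof.
move=> mf mg fg; apply: ge0_ae_eq_integral => //.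
- by apply/measurable_EFinP; exact: measurable_funX.
- by apply/measurable_EFinP; exact: measurable_funX.
- by move=> x _; rewrite lee_fin sqr_ge0.
- by move=> x _; rewrite lee_fin sqr_ge0.
- by apply: ae_imply fg => x -> _.
Qed.

Lemma norm_Linfty_le f (M : R) : {ae leb, forall x, `|f x| <= M} ->
  (norm_Linfty f <= M%:E)%E.
Proof.
move=> fM; have M0 : 0 <= M.
  have [x] : exists x, `|f x| <= M; last exact: le_trans.
  apply: contrapT => /forallNP nfM; have [N [mN N0 fN]] := fM.
  have NT : N = setT by apply/seteqP; split => // x _; apply: fN; exact: nfM.
  have : (leb (`[0%R, 1%R]%classic : set R) <= leb N)%E.
    by apply: le_measure; rewrite ?inE// NT.
  rewrite N0; have /= -> := @lebesgue_measure_itv R `[0%R, 1%R].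
  by rewrite lte_fin ltr01 -EFinD lee_fin subr0 ler10.
rewrite /norm_Linfty unlock; case: ifPn => // _.
by apply/ess_supP; apply: ae_imply fM => x; rewrite /= lee_fin.
Qed.

Lemma Linfty_le f (M : R) : measurable_fun setT f ->
  {ae leb, forall x, `|f x| <= M} -> Linfty f.
Proof.
move=> mf fM; rewrite /Linfty inE; apply/andP; split; rewrite inE//=.
by rewrite /finite_norm (le_lt_trans (norm_Linfty_le fM))// ltry.
Qed.

(** Cauchy-Schwarz against 1, from nonnegativity of the integral of (f - m)^2 with [m] the mean of
    [f]. *)
Lemma Rintegral_sqr_le f (a b : R) : measurable_fun setT f ->
  leb.-integrable `]a, b] (EFin \o f) ->
  leb.-integrable `]a, b] (EFin \o (fun x => f x ^+ 2)) -> a <= b ->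
  (\int[leb]_(x in `]a, b]) f x) ^+ 2 <=
  (b - a) * \int[leb]_(x in `]a, b]) f x ^+ 2.
Proof.
move=> mf intf intf2; rewrite le_eqVlt => /predU1P[->|ab].
  by rewrite set_itv_ge ?bnd_simp ?ltxx// !Rintegral_set0 expr0n/= mulr0.
set I1 := \int[leb]_(x in `]a, b]) f x; set I2 := \int[leb]_(x in `]a, b]) _ x ^+ 2.
pose m := I1 / (b - a).
have ba : 0 < b - a by rewrite subr_gt0.
have icst (c : R) : leb.-integrable `]a, b] (EFin \o (fun=> c)).
  by apply: (@bounded_integrable_itv _ _ _ _ `|c|).
have imf : leb.-integrable `]a, b] (EFin \o (fun x => (2 * m) * f x)).
  have -> : EFin \o (fun x => (2 * m) * f x) =
    (fun x => (2 * m)%:E * (EFin \o f) x)%E by apply/funext.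
  exact: integrableZl.
have : 0 <= \int[leb]_(x in `]a, b]) (f x - m) ^+ 2.
  by apply: Rintegral_ge0 => x _; exact: sqr_ge0.
have -> : \int[leb]_(x in `]a, b]) (f x - m) ^+ 2 =
    \int[leb]_(x in `]a, b]) ((f x ^+ 2 - (2 * m) * f x) + m ^+ 2).
  by apply: eq_Rintegral => x _; ring.
rewrite RintegralD//; last exact: (integrableB _ intf2 imf).
rewrite RintegralB// RintegralZl// Rintegral_cst// -/I1 -/I2.
have /= -> := @lebesgue_measure_itv R `]a, b].
rewrite lte_fin ab -EFinD /= => H.
have : 0 <= (b - a) * (I2 - 2 * m * I1 + m ^+ 2 * (b - a)) by rewrite mulr_ge0// ltW.
have -> : (b - a) * (I2 - 2 * m * I1 + m ^+ 2 * (b - a)) = (b - a) * I2 - I1 ^+ 2.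
  by rewrite /m; field; rewrite gt_eqF.
by rewrite subr_ge0.
Qed.

Lemma Rintegral_itv_le f (a b : R) : leb.-integrable setT (EFin \o f) ->
  (forall x, 0 <= f x) ->
  \int[leb]_(x in `]a, b]) f x <= \int[leb]_x f x.
Proof.
move=> intf f0; rewrite /Rintegral; apply: fine_le.
- by apply: integrable_fin_num => //; exact: integrableS intf.
- exact: integrable_fin_num.
- apply: ge0_subset_integral => //; first exact: measurable_int intf.
  by move=> x _; rewrite lee_fin.
Qed.

Lemma H1_primitive u : H1 u -> primitive u (wderiv u).
Proof. by case=> cu _ wdu _; exact: wderiv_primitive. Qed.

Lemma H1_holder u (a b : R) : H1 u -> a <= b ->
  (u b - u a) ^+ 2 <= (b - a) * \int[leb]_(x in `]a, b]) wderiv u x ^+ 2.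
Proof.
move=> hu ab; have [lu ->//] := H1_primitive hu.
have [_ _ _ L2u] := hu.
apply: Rintegral_sqr_le => //; first exact: L2_measurable.
  exact: locally_integrable_itvoc.
exact: integrableS (L2_integrable_sqr L2u).
Qed.

(** u(x)^2 <= 2 u(t)^2 + 2 (u(t) - u(x))^2, averaged over t in ]x, x + 1], with the increment
    controlled by [H1_holder]. *)
Lemma H1_bounded u : H1 u -> exists K : R, forall x, `|u x| <= K.
Proof.
move=> hu; have [cu L2u _ L2u'] := hu.
have i2 := L2_integrable_sqr L2u; have i2' := L2_integrable_sqr L2u'.
pose K0 := \int[leb]_x u x ^+ 2; pose K1 := \int[leb]_x wderiv u x ^+ 2.
(* The summand 1 comes from |u| <= 1 + u^2, which avoids a square root. *)
exists (1 + (2 * K0 + 2 * K1)) => x.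
have x1 : x <= x + 1 by rewrite lerDl.
suff H : u x ^+ 2 <= 2 * K0 + 2 * K1.
  have : (`|u x| - 1) ^+ 2 >= 0 by exact: sqr_ge0.
  rewrite sqrrB1 real_normK ?num_real//.
  by have := normr_ge0 (u x); lra.
have K10 : 0 <= K1 by apply: Rintegral_ge0 => *; exact: sqr_ge0.
have icst (c : R) : leb.-integrable `]x, x + 1] (EFin \o (fun=> c)).
  by apply: (@bounded_integrable_itv _ _ _ _ `|c|).
have i2x : leb.-integrable `]x, x + 1] (EFin \o (fun t => u t ^+ 2)).
  exact: integrableS i2.
have len c : \int[leb]_(_ in `]x, x + 1]) c = c.
  rewrite Rintegral_cst//; have /= -> := @lebesgue_measure_itv R `]x, x + 1].
  by rewrite lte_fin ltrDl ltr01 -EFinD /= addrAC subrr add0r mulr1.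
have i2x2 : leb.-integrable `]x, x + 1] (EFin \o (fun t => 2 * u t ^+ 2)).
  have -> : EFin \o (fun t => 2 * u t ^+ 2) =
    (fun t => 2%:E * (EFin \o (fun s => (u s ^+ 2)%R)) t)%E by apply/funext.
  exact: integrableZl.
apply: (@le_trans _ _ (\int[leb]_(t in `]x, x + 1]) (2 * u t ^+ 2 + 2 * K1))).
  rewrite -[leLHS]len; apply: le_Rintegral => //.
    exact: (integrableD _ i2x2 (icst _)).
  move=> t /=; rewrite in_itv/= => /andP[xt tx].
  have := H1_holder hu (ltW xt).
  have : \int[leb]_(s in `]x, t]) wderiv u s ^+ 2 <= K1.
    by apply: Rintegral_itv_le => // *; exact: sqr_ge0.
  set J := \int[leb]_(s in _) _ => JK H.
  have J0 : 0 <= J by apply: Rintegral_ge0 => *; exact: sqr_ge0.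
  have : (u t - u x) ^+ 2 <= K1 by nra.
  by have := sqr_ge0 (u x - 2 * u t); nra.
rewrite RintegralD// len RintegralZl// lerD2r ler_pM2l//.
by apply: Rintegral_itv_le => // *; exact: sqr_ge0.
Qed.

Lemma primitive_cst_id (c : R) : primitive (fun x => c * x) (fun=> c).
Proof.
split; first by apply: continuous_locally_integrable => x; exact: cvg_cst.
move=> a b ab; rewrite Rintegral_cst//.
have /= -> := @lebesgue_measure_itv R `]a, b]; rewrite lte_fin.
move: ab; rewrite le_eqVlt => /predU1P[->|ab].
  by rewrite ltxx /= mulr0 subrr.
by rewrite ab -EFinD /= mulrBr.
Qed.

End Norms.

(** * The image of L lies in F_0 *)

Section MembershipF0.
Context {R : realType}.
Local Notation leb := (@lebesgue_measure R).

Section ProfileFacts.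
Variables (d : eulerian R) (A B h : R -> R).
Hypothesis P : L_profile d A B h.

Lemma prof_h1_sqr xi : A xi ^+ 2 + B xi ^+ 2 = h xi * (1 - h xi).
Proof. by have := prof_sphere P xi; lra. Qed.

Lemma prof_A_sqr_le xi : A xi ^+ 2 <= h xi.
Proof.
have := prof_sphere P xi; have := sqr_ge0 (h xi); have := sqr_ge0 (B xi); lra.
Qed.

Lemma prof_B_sqr_le xi : B xi ^+ 2 <= h xi.
Proof.
have := prof_sphere P xi; have := sqr_ge0 (h xi); have := sqr_ge0 (A xi); lra.
Qed.

Lemma prof_h_sqr_le xi : h xi ^+ 2 <= h xi.
Proof.
have := prof_sphere P xi; have := sqr_ge0 (B xi); have := sqr_ge0 (A xi); lra.
Qed.

Let sqr_le1 (t : R) : t ^+ 2 <= 1 -> `|t| <= 1.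
Proof. by rewrite -real_normK ?num_real// expr_le1. Qed.

Lemma prof_A_le1 xi : `|A xi| <= 1.
Proof. exact/sqr_le1/(le_trans (prof_A_sqr_le _))/(prof_h_le1 P). Qed.

Lemma prof_B_le1 xi : `|B xi| <= 1.
Proof. exact/sqr_le1/(le_trans (prof_B_sqr_le _))/(prof_h_le1 P). Qed.

Lemma prof_h_norm_le1 xi : `|h xi| <= 1.
Proof. by rewrite ger0_norm ?(prof_h_ge0 P)// (prof_h_le1 P). Qed.

(** [h] has total integral mu(R), so domination of the square by [h] gives an L^2 bound; the sphere
    identity provides it for U_xi, rbar and [h] itself. *)
Lemma prof_integral_sqr_le (f : R -> R) : measurable_fun setT f ->
  (forall xi, f xi ^+ 2 <= h xi) ->
  (\int[leb]_xi (f xi ^+ 2)%:E <= (e_Finfty d)%:E)%E.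
Proof.
move=> mf fh; rewrite -(prof_HT P); apply: ge0_le_integral => //.
- by move=> x _; rewrite lee_fin sqr_ge0.
- by apply/measurable_EFinP; exact: measurable_funX.
- by apply/measurable_EFinP; exact: prof_meash P.
- by move=> x _; rewrite lee_fin.
Qed.

Lemma prof_L2 (f g : R -> R) : measurable_fun setT f -> measurable_fun setT g ->
  {ae leb, forall xi, g xi = f xi} -> (forall xi, f xi ^+ 2 <= h xi) -> L2 g.
Proof.
move=> mf mg gf fh; apply: L2P => //; rewrite (ae_eq_integral_sqr mg mf gf).
by rewrite (le_lt_trans (prof_integral_sqr_le mf fh))// ltry.
Qed.

Lemma prof_zeta : primitive (l_zeta (L d)) (fun xi => - h xi).
Proof.
have := primitiveB (prof_y P) (primitive_cst_id 1).
congr primitive; apply/funext => xi /=; first by rewrite mul1r.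
by ring.
Qed.

Lemma prof_wderiv_y : {ae leb, forall xi, wderiv (L_y d) xi = 1 - h xi}.
Proof. exact: wderiv_ae (prof_y P). Qed.

Lemma prof_lh : {ae leb, forall xi, l_h (L d) xi = h xi}.
Proof. by apply: ae_imply prof_wderiv_y => xi /= ->; rewrite opprB addrC subrK. Qed.

Lemma prof_wderiv_U : {ae leb, forall xi, wderiv (l_U (L d)) xi = A xi}.
Proof. exact: wderiv_ae (prof_U P). Qed.

Lemma measurable_wderiv (f g : R -> R) : primitive f g ->
  measurable_fun setT (wderiv f).
Proof.
move=> pf; have [] // := wderiv_primitive (primitive_continuous pf)
  (primitive_weakly_differentiable pf).
by case.
Qed.

Lemma measurable_lh : measurable_fun setT (l_h (L d)).
Proof. by apply: measurable_funB => //; exact: measurable_wderiv (prof_y P). Qed.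

End ProfileFacts.

Lemma zeta_bound (d : eulerian R) xi : `|l_zeta (L d) xi| <= e_Finfty d.
Proof.
rewrite ler_norml /=; have := L_y_lex d xi; have := L_y_ge d xi.
by have := e_Finfty_ge0 d => *; apply/andP; split; lra.
Qed.

(** Composition with y adds the integral of f^2 against mu, controlled by the sup bound and the
    finite total mass. *)
Lemma integral_L_y_sqr_le (d : eulerian R) (f : R -> R) (K : R) :
  measurable_fun setT f -> (forall x, `|f x| <= K) ->
  (\int[leb]_xi (f (L_y d xi) ^+ 2)%:E <=
   \int[leb]_x (f x ^+ 2)%:E + (K ^+ 2 * e_Finfty d)%:E)%E.
Proof.
move=> mf fK.
rewrite (@ge0_integral_L_y _ d (fun x => (f x ^+ 2)%:E)); last 2 first.
- by apply/measurable_EFinP; exact: measurable_funX.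
- by move=> x; rewrite lee_fin sqr_ge0.
rewrite leeD2l// EFinM e_FinftyE.
rewrite -[leRHS](@integral_cst _ _ _ (e_mu d) setT measurableT (K ^+ 2)%:E).
apply: ge0_le_integral => //.
- by move=> x _; rewrite lee_fin sqr_ge0.
- by apply/measurable_EFinP; exact: measurable_funX.
- move=> x _; rewrite /cst lee_fin.
  by rewrite -(@real_normK _ (f x)) ?num_real// ler_sqr ?nnegrE// (le_trans _ (fK x)).
Qed.

Lemma L_in_F0 (d : eulerian R) : in_D d -> in_F0 (L d).
Proof.
move=> Hd; have [A [B [h P]]] := L_profile_exists Hd.
have [hu L2rho _] := Hd; have [cu L2u _ _] := hu.
have [K uK] := H1_bounded hu.
have mu := continuous_measurable_fun cu.
have pz := prof_zeta P; have pU := prof_U P.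
have mh := prof_meash P; have mA := prof_measA P; have mB := prof_measB P.
have cz := primitive_continuous pz; have cU := primitive_continuous pU.
have mz := continuous_measurable_fun cz; have mU := continuous_measurable_fun cU.
have wz := wderiv_ae pz; have wU := prof_wderiv_U P.
have mwz := measurable_wderiv pz; have mwU := measurable_wderiv pU.
have mwy := measurable_wderiv (prof_y P).
have mrbar : measurable_fun setT (l_rbar (L d)).
  apply: measurable_funM => //.
  exact: measurableT_comp (measurable_e_rhobar Hd) (measurable_L_y d).
have lyxi : l_yxi (L d) = wderiv (L_y d) by rewrite /l_yxi l_y_L.
split.
- split.
  + split => //.
    * by apply: (@Linfty_le _ _ (e_Finfty d)) => //; apply: aeW => x; exact: zeta_bound.
    * exact: primitive_weakly_differentiable pz.
    * apply: (prof_L2 P _ mwz wz); first exact: measurable_funN.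
      by move=> xi; rewrite sqrrN (prof_h_sqr_le P).
  + split => //.
    * apply: L2P => //.
      apply: le_lt_trans (integral_L_y_sqr_le d mu uK) _.
      by rewrite lte_add_pinfty ?ltry// L2_sqr_lty.
    * exact: primitive_weakly_differentiable pU.
    * exact: (prof_L2 P mA mwU wU (prof_A_sqr_le P)).
  + exact: (prof_L2 P mh (measurable_lh P) (prof_lh P) (prof_h_sqr_le P)).
  + exact: (prof_L2 P mB mrbar (prof_rbar P) (prof_B_sqr_le P)).
- split.
  + by apply: (@Linfty_le _ _ (e_Finfty d)) => //; apply: aeW => x; exact: zeta_bound.
  + exact: primitive_weakly_differentiable pz.
  + apply: (@Linfty_le _ _ 1) => //; apply: ae_imply wz => xi ->.
    by rewrite normrN (prof_h_norm_le1 P).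
- split.
  + by apply: (@Linfty_le _ _ K) => //; apply: aeW => x; exact: uK.
  + exact: primitive_weakly_differentiable pU.
  + apply: (@Linfty_le _ _ 1) => //; apply: ae_imply wU => xi ->.
    exact: prof_A_le1 P _.
- apply: (@Linfty_le _ _ 1); first exact: measurable_lh P.
  by apply: ae_imply (prof_lh P) => xi ->; exact: prof_h_norm_le1 P _.
(* r = rbar + k y_xi with |rbar| <= 1 and 0 <= y_xi <= 1. *)
- apply: (@Linfty_le _ _ (1 + `|e_k d|)).
    by apply: measurable_funD => //; rewrite lyxi; exact: measurable_funM.
  apply: ae_imply2 (prof_rbar P) (prof_wderiv_y P) => xi rB yh.
  rewrite /l_r lyxi [l_rbar _ _]rB yh (le_trans (ler_normD _ _))// lerD//.
    exact: prof_B_le1 P _.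
  rewrite normrM ler_piMr// ger0_norm ?subr_ge0 ?(prof_h_le1 P)//.
  by rewrite gerBl (prof_h_ge0 P).
- rewrite lyxi; apply: ae_imply (prof_wderiv_y P) => xi ->.
  by rewrite subr_ge0 (prof_h_le1 P).
- by apply: ae_imply (prof_lh P) => xi ->; exact: prof_h_ge0 P _.
- rewrite lyxi; apply: ae_imply (prof_wderiv_y P) => xi /= ->.
  by rewrite addrC subrK ltr01.
- have yU : {ae leb, forall xi, wderiv (L_y d) xi = 1 - h xi /\
      wderiv (l_U (L d)) xi = A xi}.
    by apply: ae_imply2 (prof_wderiv_y P) wU => xi.
  rewrite lyxi; apply: ae_imply2 yU (prof_rbar P) => xi [yh UA] rB.
  rewrite UA [l_rbar _ _]rB (prof_h1_sqr P) /= yh; ring.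
- move=> xi; rewrite l_y_L; transitivity
    ((L_y d xi)%:E + \int[leb]_(eta in `]-oo, xi]) (h eta)%:E)%E.
    congr (_ + _)%E; apply: ae_eq_integral => //.
    + by apply/measurable_EFinP; apply: measurable_funTS; exact: measurable_lh P.
    + by apply/measurable_EFinP; exact: measurable_funTS mh.
    + by apply: ae_imply (prof_lh P) => t -> _.
  by rewrite (prof_H P) -EFinD addrC subrK.
Qed.

End MembershipF0.

(** * Uniform convergence of the characteristics *)

Section UniformConvergence.
Context {R : realType}.
Local Notation leb := (@lebesgue_measure R).

(** A monotone function has countably many jumps, a null set that cannot contain an interval.
    Outside the jumps the one-sided limits agree, and the right one is the value. *)
Lemma e_F_continuity_point (d : eulerian R) (a b : R) : a < b ->
  exists2 c : R, a < c < b & {for c, continuous (e_F d)}.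
Proof.
move=> ab; have nd : {in `[a, b] &, nondecreasing_fun (e_F d)}.
  by move=> x y _ _; exact: e_F_nd.
have := discontinuity_countable nd.
set S := [set x | _] => /countable_lebesgue_measure0 S0.
have [c abc nSc] : exists2 c : R, a < c < b & ~ S c.
  apply: contrapT => H.
  have abS : `]a, b[%classic `<=` S.
    move=> c /=; rewrite in_itv/= => abc; apply: contrapT => nSc.
    by apply: H; exists c.
  have mS : measurable (S : set (measurableTypeR R)).
    apply: countable_measurable; first exact: measurable_set1.
    exact: discontinuity_countable nd.
  have : (leb (`]a, b[%classic : set R) <= lebesgue_measure S)%E.
    by apply: le_measure; rewrite ?inE.
  rewrite S0; have /= -> := @lebesgue_measure_itv R `]a, b[.
  by rewrite lte_fin ab -EFinD lee_fin leNgt subr_gt0 ab.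
exists c => //.
have rc : e_F d x @[x --> c^'+] --> e_F d c.
  apply/cvgrPdist_lt => e e0; have [del del0 Hdel] := e_F_right d c e0.
  near=> z.
  have cz : c < z by near: z; exact: nbhs_right_gt.
  have zd : z < c + del by near: z; apply: nbhs_right_lt; rewrite ltrDl.
  rewrite distrC ger0_norm ?subr_ge0 ?e_F_nd ?(ltW cz)//.
  by have := e_F_nd d (ltW zd); lra.
have lc : cvg (e_F d x @[x --> c^'-]).
  apply: nondecreasing_at_left_is_cvgr.
    by apply: nearW => x u v _ _; exact: e_F_nd.
  by apply: nearW => x; exists (e_Finfty d) => _ [z _ <-]; exact: e_F_le.
apply/left_right_continuousP; split => //.
have limr : lim (e_F d x @[x --> c^'+]) = e_F d c by exact/cvg_lim.
suff <- : lim (e_F d x @[x --> c^'-]) = e_F d c by [].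
rewrite -limr; apply/eqP; apply: contrapT => /negP nlim.
apply: nSc; split; first by rewrite in_itv.
by split => //; apply/cvg_ex; exists (e_F d c).
Unshelve. all: by end_near. Qed.

Lemma e_F_Ny (d : eulerian R) (e : R) : 0 < e -> exists x, e_F d x < e.
Proof.
move=> e0; pose A n := `]-oo, (- n%:R : R)]%classic : set (measurableTypeR R).
have mA n : measurable (A n) by exact: measurable_itv.
have AE : \bigcap_n A n = set0.
  apply/seteqP; split => // x Ax; have := Ax (Num.bound `|x|) I.
  rewrite /A /= in_itv/= leNgt => /negP; apply.
  rewrite ltrNl (le_lt_trans (ler_norm _))// normrN.
  by rewrite archi_boundP.
have : e_mu d (A n) @[n --> \oo] --> e_mu d (\bigcap_n A n).
  apply: nonincreasing_cvg_mu => //.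
  - by rewrite ltey_eq fin_num_measure.
  - by rewrite AE.
  - move=> m n mn; apply/subsetPset; apply: subset_itvl; rewrite bnd_simp.
    by rewrite lerN2 ler_nat.
rewrite AE measure0 -[X in _ --> X -> _]/((0 : R)%:E).
move=> /fine_cvgP[_ /cvgrPdist_lt/(_ e e0)[n _ /(_ n (leqnn n))]] /=.
by rewrite sub0r normrN => /(le_lt_trans (ler_norm _)) H; exists (- n%:R).
Qed.

Lemma e_F_y (d : eulerian R) (e : R) : 0 < e -> exists x, e_Finfty d - e < e_F d x.
Proof.
move=> e0; pose A n := `]-oo, (n%:R : R)]%classic : set (measurableTypeR R).
have mA n : measurable (A n) by exact: measurable_itv.
have AE : \bigcup_n A n = setT.
  apply/seteqP; split => // x _; exists (Num.bound `|x|) => //.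
  rewrite /A /= in_itv/= ltW// (le_lt_trans (ler_norm _))//.
  by rewrite archi_boundP.
have : e_mu d (A n) @[n --> \oo] --> e_mu d (\bigcup_n A n).
  apply: nondecreasing_cvg_mu => //.
  - by rewrite AE.
  - move=> m n mn; apply/subsetPset; apply: subset_itvl; rewrite bnd_simp.
    by rewrite ler_nat.
rewrite AE -e_FinftyE.
move=> /fine_cvgP[_ /cvgrPdist_lt/(_ e e0)[n _ /(_ n (leqnn n))]] /= H.
exists n%:R; rewrite ltrBlDr -ltrBlDl.
exact: le_lt_trans (ler_norm _) H.
Qed.

Lemma L_y_H_le (d : eulerian R) (a b : R) : a <= b ->
  a - L_y d a <= b - L_y d b.
Proof. by move=> ab; have := L_y_lip d ab; lra. Qed.

(** At xi = x + F(x) one has xi - y(xi) = F(x), so the limits of [F] at both infinities transfer to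
    the nondecreasing function xi - y(xi). *)
Lemma L_y_tails (d : eulerian R) (e : R) : 0 < e -> exists a b,
  [/\ a <= b, a - L_y d a < e & e_Finfty d - e < b - L_y d b].
Proof.
move=> e0; have [xa Fxa] := e_F_Ny d e0; have [xb Fxb] := e_F_y d e0.
pose a := xa + e_F d xa; pose b := Num.max a (xb + e_F d xb).
exists a, b; split; first by rewrite le_max lexx.
  by rewrite L_yK /a; lra.
apply: (@lt_le_trans _ _ (xb + e_F d xb - L_y d (xb + e_F d xb))).
  by rewrite L_yK; lra.
by apply: L_y_H_le; rewrite le_max lexx orbT.
Qed.

Variables (dn : nat -> eulerian R) (d : eulerian R).
Hypothesis FnF : forall x : R, {for x, continuous (e_F d)} ->
  e_F (dn n) x @[n --> \oo] --> e_F d x.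
Hypothesis MnM : e_Finfty (dn n) @[n --> \oo] --> e_Finfty d.

(** Bracket y(xi) by continuity points a < y(xi) < b of [F]. Then a + F(a) < xi < b + F(b) strictly,
    which persists for F_n and puts y_n(xi) in ]a, b]. *)
Lemma L_y_cvg (xi : R) : L_y (dn n) xi @[n --> \oo] --> L_y d xi.
Proof.
apply/cvgrPdist_le => e e0; set x := L_y d xi.
have [a /andP[xa ax] ca] : exists2 a : R, x - e < a < x & {for a, continuous (e_F d)}.
  by apply: e_F_continuity_point; lra.
have [b /andP[xb bx] cb] : exists2 b : R, x < b < x + e & {for b, continuous (e_F d)}.
  by apply: e_F_continuity_point; lra.
have Fa : a + e_F d a < xi by rewrite -L_y_gt.
have Fb : xi < b + e_F d b.
  have : xi <= x + e_F d x by rewrite -L_y_le.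
  by have := e_F_nd d (ltW xb); lra.
have ea : 0 < xi - (a + e_F d a) by lra.
have eb : 0 < b + e_F d b - xi by lra.
have /cvgrPdist_lt/(_ _ ea) Ha := FnF ca.
have /cvgrPdist_lt/(_ _ eb) Hb := FnF cb.
near=> n.
have : `|e_F d a - e_F (dn n) a| < xi - (a + e_F d a) by near: n.
have : `|e_F d b - e_F (dn n) b| < b + e_F d b - xi by near: n.
rewrite !ltr_norml => /andP[? ?] /andP[? ?].
have H1 : a < L_y (dn n) xi by rewrite L_y_gt; lra.
have H2 : L_y (dn n) xi <= b by rewrite L_y_le; lra.
by rewrite ler_norml; apply/andP; split; lra.
Unshelve. all: by end_near. Qed.

(** On [a, b] a finite grid suffices, all maps being nondecreasing and 1-Lipschitz. Outside, xi - y
    and xi - y_n are monotone with values between 0 and the total mass; they are close to 0 on the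
    left and, since the masses converge, close to each other on the right. *)
Lemma L_y_cvg_uniform (e : R) : 0 < e ->
  \forall n \near \oo, forall xi, `|L_y (dn n) xi - L_y d xi| <= e.
Proof.
move=> e0.
have e4 : 0 < e / 4 by lra.
have [a [b [ab Ha Hb]]] := L_y_tails d e4.
pose N := Num.bound ((b - a) / (e / 4)).
pose p (i : nat) : R := a + i%:R * (e / 4).
have Hp : \forall n \near \oo, forall i : 'I_N.+1,
    `|L_y d (p i) - L_y (dn n) (p i)| < e / 4.
  apply: filter_forall => i.
  by have /cvgrPdist_lt/(_ _ e4) := @L_y_cvg (p i).
have /cvgrPdist_lt/(_ _ e4) Hna := @L_y_cvg a.
have /cvgrPdist_lt/(_ _ e4) Hnb := @L_y_cvg b.
have /cvgrPdist_lt/(_ _ e4) HM := MnM.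
near=> n => xi.
have : `|L_y d a - L_y (dn n) a| < e / 4 by near: n.
have : `|L_y d b - L_y (dn n) b| < e / 4 by near: n.
have : `|e_Finfty d - e_Finfty (dn n)| < e / 4 by near: n.
have Hpn : forall i : 'I_N.+1, `|L_y d (p i) - L_y (dn n) (p i)| < e / 4 by near: n.
rewrite !ltr_norml => /andP[? ?] /andP[? ?] /andP[? ?].
have := L_y_lex d xi; have := L_y_lex (dn n) xi.
have := L_y_ge d xi; have := L_y_ge (dn n) xi => ? ? ? ?.
have [xia|axi] := leP xi a.
  have := L_y_H_le d xia; have := L_y_H_le (dn n) xia => ? ?.
  by rewrite ler_norml; apply/andP; split; lra.
have [bxi|xib] := leP b xi.
  have := L_y_H_le d bxi; have := L_y_H_le (dn n) bxi => ? ?.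
  by rewrite ler_norml; apply/andP; split; lra.
pose i := Num.truncn ((xi - a) / (e / 4)).
have xia0 : 0 <= (xi - a) / (e / 4) by rewrite divr_ge0//; lra.
have := truncn_itv xia0; rewrite -/i => /andP[ixi xii].
have iN : (i < N.+1)%N.
  rewrite -(ltr_nat R) (le_lt_trans ixi)// (@le_lt_trans _ _ ((b - a) / (e / 4)))//.
    by rewrite ler_pM2r ?invr_gt0// lerD2r ltW.
  rewrite (lt_trans (archi_boundP _))//; first by rewrite divr_ge0//; lra.
  by rewrite ltr_nat.
have := Hpn (Ordinal iN); rewrite /= ltr_norml => /andP[? ?].
have p1 : p i <= xi by move: ixi; rewrite ler_pdivlMr// /p; lra.
have p2 : xi <= p i + e / 4.
  by move: xii; rewrite ltr_pdivrMr// -natr1 mulrDl mul1r /p; lra.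
have := L_y_lip d p1; have := L_y_lip (dn n) p1.
have := L_y_nd d p1; have := L_y_nd (dn n) p1 => ? ? ? ?.
by rewrite ler_norml; apply/andP; split; lra.
Unshelve. all: by end_near. Qed.

End UniformConvergence.

(** * Working form of the norms for limits *)

Section NormConvergence.
Context {R : realType}.
Local Notation leb := (@lebesgue_measure R).
Implicit Types f g u : R -> R.

Lemma cvge0P (u : nat -> \bar R) : (forall n, (0 <= u n)%E) ->
  u n @[n --> \oo] --> 0%E <->
  forall e : R, 0 < e -> \forall n \near \oo, (u n <= e%:E)%E.
Proof.
move=> u0; rewrite -[X in _ --> X]/((0 : R)%:E); split.
  move=> /fine_cvgP[ufin /cvgrPdist_le uc] e e0.
  near=> n; have ufn : u n \is a fin_num by near: n.
  rewrite -(fineK ufn) lee_fin.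
  have : `|0 - (fine \o u) n| <= e by near: n; exact: uc.
  by rewrite sub0r normrN ger0_norm// fine_ge0.
move=> H; apply/fine_cvgP; split.
  near=> n; rewrite ge0_fin_numE// (@le_lt_trans _ _ 1%:E) ?ltry//.
  by near: n; exact: H.
apply/cvgrPdist_le => e e0; near=> n.
have un : (u n <= e%:E)%E by near: n; exact: H.
rewrite sub0r normrN ger0_norm ?fine_ge0// -lee_fin fineK//.
by rewrite ge0_fin_numE// (le_lt_trans un) ?ltry.
Unshelve. all: by end_near. Qed.

Lemma norm_L2_le f (e : R) : 0 <= e ->
  (norm_L2 f <= e%:E)%E = (\int[leb]_x (f x ^+ 2)%:E <= (e ^+ 2)%:E)%E.
Proof.
move=> e0; rewrite norm_L2E; set I := (\int[leb]_x _)%E.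
have I0 : (0 <= I)%E by apply: integral_ge0 => x _; rewrite lee_fin sqr_ge0.
have sqe : ((e ^+ 2)%:E `^ 2^-1 = e%:E)%E.
  by rewrite poweR_EFin powR12_sqrt ?sqr_ge0// sqrtr_sqr ger0_norm.
case: I I0 => [r| |]//.
- rewrite !lee_fin => r0.
  by rewrite powR12_sqrt// -[in RHS](sqr_sqrtr r0) ler_sqr ?nnegrE ?sqrtr_ge0.
- by move=> _; rewrite poweRyr ?invr_eq0// !leye_eq.
Qed.

Lemma norm_L2_ge0 f : (0 <= norm_L2 f)%E.
Proof. exact: Lnorm_ge0. Qed.

Lemma norm_H1_le f (e : R) : 0 <= e -> (norm_L2 f <= e%:E)%E ->
  (norm_L2 (wderiv f) <= e%:E)%E -> (norm_H1 f <= (2 * e)%:E)%E.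
Proof.
move=> e0 fe f'e; rewrite /norm_H1.
have sqe : ((2 * e)%:E = ((2 * e) ^+ 2)%:E `^ 2^-1)%E.
  by rewrite poweR_EFin powR12_sqrt ?sqr_ge0// sqrtr_sqr ger0_norm ?mulr_ge0.
rewrite sqe; apply: gt0_ler_poweR => //.
- by rewrite in_itv/= leey adde_ge0// mule_ge0// norm_L2_ge0.
- by rewrite in_itv/= leey lee_fin sqr_ge0.
have sq_le (t : \bar R) : (0 <= t -> t <= e%:E -> t ^+ 2 <= (e ^+ 2)%:E)%E.
  by move=> t0 te; rewrite expe2 expr2 EFinM lee_pmul.
apply: (@le_trans _ _ ((e ^+ 2)%:E + (e ^+ 2)%:E)%E).
  by apply: leeD; apply: sq_le => //; exact: norm_L2_ge0.
by rewrite -EFinD lee_fin exprMn; have := sqr_ge0 e; lra.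
Qed.

(** By continuity a violation at one point spreads to an open interval, which is not null. *)
Lemma continuous_norm_Linfty_le f (M : R) : continuous f ->
  (norm_Linfty f <= M%:E)%E -> forall x, `|f x| <= M.
Proof.
move=> cf; rewrite /norm_Linfty unlock.
have leT : (0 < leb setT)%E.
  apply: (@lt_le_trans _ _ (leb (`[0%R, 1%R]%classic : set R))).
    have /= -> := @lebesgue_measure_itv R `[0%R, 1%R].
    by rewrite lte_fin ltr01 -EFinD lte_fin subr0 ltr01.
  by apply: le_measure; rewrite ?inE.
rewrite leT => /ess_supP [N [mN N0 fN]] x.
rewrite leNgt; apply/negP => Mfx.
have : `|f z| @[z --> x] --> `|f x| by apply: cvg_norm; exact: cf.
move=> /cvgr_gt/(_ _ Mfx) [e /= e0 He].
have sub : `](x - e), (x + e)[%classic `<=` N.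
  move=> z /=; rewrite in_itv/= => /andP[z1 z2]; apply: fN => /=.
  rewrite lee_fin; apply/negP; rewrite -ltNge; apply: He => /=.
  by rewrite ltr_norml; apply/andP; split; lra.
have : (leb (`](x - e)%R, (x + e)%R[%classic : set R) <= leb N)%E.
  by apply: le_measure; rewrite ?inE.
rewrite N0; have /= -> := @lebesgue_measure_itv R `](x - e), (x + e)[.
have xe : x - e < x + e by lra.
by rewrite lte_fin xe -EFinD lee_fin; lra.
Qed.

(** Tonelli: each x belongs to the window of a set of xi of length a + b. *)
Lemma integral_window f (a b : R) : 0 <= a + b -> measurable_fun setT f ->
  (forall x, 0 <= f x) ->
  (\int[leb]_xi \int[leb]_(x in `](xi - a)%R, (xi + b)%R]) (f x)%:E =
   (a + b)%:E * \int[leb]_x (f x)%:E)%E.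
Proof.
move=> ab mf f0.
pose F (z : R * R) : \bar R :=
  (f z.2 * ((z.1 - a < z.2)%R%:R * (z.2 <= z.1 + b)%R%:R))%:E.
have mF : measurable_fun setT F.
  apply/measurable_EFinP; apply: measurable_funM.
    exact: (measurableT_comp mf).
  apply: measurable_funM.
    apply: (measurableT_comp (f := fun b : bool => b%:R : R)) => //.
    by apply: measurable_fun_ltr => //; exact: measurable_funB.
  apply: (measurableT_comp (f := fun b : bool => b%:R : R)) => //.
  by apply: measurable_fun_ler => //; exact: measurable_funD.
have F0 z : (0 <= F z)%E by rewrite lee_fin mulr_ge0// mulr_ge0// ler0n.
have H := @fubini_tonelli _ _ _ _ R leb leb F mF F0.
transitivity (\int[leb]_xi \int[leb]_x F (xi, x))%E.
  apply: eq_integral => xi _; rewrite integral_mkcond; apply: eq_integral => x _.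
  rewrite patchE mem_setE/= in_itv/= /F /=.
  by case: (_ < x); case: (x <= _); rewrite /= ?mulr1 ?mulr0 ?mul0r.
rewrite H -ge0_integralZl//; last 2 first.
- exact/measurable_EFinP.
- by move=> x _; rewrite lee_fin.
apply: eq_integral => x _.
transitivity (\int[leb]_(xi in `[(x - b)%R, (x + a)%R[) (f x)%:E)%E.
  rewrite [RHS]integral_mkcond; apply: eq_integral => xi _.
  rewrite patchE mem_setE/= in_itv/= /F /= lerBlDr ltrBlDr.
  by case: (xi < _); case: (x <= _); rewrite /= ?mulr1 ?mulr0 ?mul0r.
rewrite integral_cst//; have /= -> := @lebesgue_measure_itv R `[(x - b), (x + a)[.
rewrite lte_fin muleC; case: ifPn => [_|].
  by rewrite -EFinD; congr (_%:E * _)%E; ring.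
rewrite -leNgt => H'; have -> : a + b = 0 by lra.
by [].
Qed.

Lemma L2_locally_integrable f : L2 f -> locally_integrable setT f.
Proof.
move=> L2f; have mf := L2_measurable L2f.
apply: itv_locally_integrable => // a b.
have i2 : leb.-integrable `[a, b] (EFin \o (fun x => f x ^+ 2)).
  exact: integrableS (L2_integrable_sqr L2f).
have i1 : leb.-integrable `[a, b] (EFin \o (fun=> 1 : R)).
  apply: locally_integrable_itvcc; apply: continuous_locally_integrable => x.
  exact: cvg_cst.
apply: le_integrable (integrableD _ i1 i2) => //.
  by apply/measurable_EFinP; exact: measurable_funTS mf.
move=> x _ /=; rewrite lee_fin [leRHS]ger0_norm ?addr_ge0 ?sqr_ge0//.
have : 0 <= (`|f x| - 1) ^+ 2 by exact: sqr_ge0.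
rewrite sqrrB1 real_normK ?num_real//.
by have := normr_ge0 (f x); lra.
Qed.

End NormConvergence.

(** * Convergence of U_n = u_n(y_n) *)

Section Convergence.
Context {R : realType}.
Local Notation leb := (@lebesgue_measure R).
Variables (dn : nat -> eulerian R) (d : eulerian R).
Hypothesis Hdn : forall n, in_D (dn n).
Hypothesis Hd : in_D d.
Hypothesis Hcvg : cvg_D dn d.
Local Notation M := (e_Finfty d).

Let Hy xi := L_y_cvg (cvg_F Hcvg) (xi := xi).
Let Hyu := L_y_cvg_uniform (cvg_F Hcvg) (cvg_Finfty Hcvg).

Let cun n : continuous (e_u (dn n)). Proof. by case: (Hdn n) => -[]. Qed.
Let cu : continuous (e_u d). Proof. by case: Hd => -[]. Qed.
Let hu : H1 (e_u d). Proof. by case: Hd. Qed.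

Lemma near_e_Finfty_le : \forall n \near \oo, e_Finfty (dn n) <= M + 1.
Proof.
have /cvgrPdist_le/(_ 1 ltr01) := cvg_Finfty Hcvg.
by apply: filterS => n; rewrite ler_norml => /andP[]; lra.
Qed.

Lemma near_e_u_uniform (e : R) : 0 < e ->
  \forall n \near \oo, forall x, `|e_u (dn n) x - e_u d x| <= e.
Proof.
move=> e0; have := cvg_u_Linfty Hcvg => /cvge0P H.
have {}H := H (fun=> Lnorm_ge0 _ _ _) e e0.
apply: filterS H => n Hn x.
apply: (@continuous_norm_Linfty_le _ (e_u (dn n) \- e_u d)) => // z.
by apply: cvgB; [exact: cun|exact: cu].
Qed.

Lemma L_U_pointwise_cvg xi : l_U (L (dn n)) xi @[n --> \oo] --> l_U (L d) xi.
Proof.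
apply/cvgrPdist_le => e e0; have e20 : 0 < e / 2 by lra.
have Hu := near_e_u_uniform e20.
have /cvgrPdist_le/(_ _ e20) Huy : e_u d (L_y (dn n) xi) @[n --> \oo] --> e_u d (L_y d xi).
  by apply: (cvg_comp _ (e_u d) (@Hy xi)); exact: cu.
near=> n; rewrite /L /=.
have H1 : `|e_u (dn n) (L_y (dn n) xi) - e_u d (L_y (dn n) xi)| <= e / 2.
  by near: n; apply: filterS Hu => n; apply.
have H2 : `|e_u d (L_y d xi) - e_u d (L_y (dn n) xi)| <= e / 2 by near: n.
move: H1 H2; rewrite !ler_norml => /andP[? ?] /andP[? ?]; apply/andP; split; lra.
Unshelve. all: by end_near. Qed.

(** The points y(xi) and y_n(xi) are at most [s] apart, and y(xi) lies in [xi - M, xi]. The segment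
    between them thus stays in the displayed window, and the Hoelder bound for u applies on it. *)
Lemma L_U_sqr_diff_le n xi (s : R) : 0 <= s ->
  `|L_y (dn n) xi - L_y d xi| <= s ->
  (l_U (L (dn n)) xi - l_U (L d) xi) ^+ 2 <=
  2 * (e_u (dn n) (L_y (dn n) xi) - e_u d (L_y (dn n) xi)) ^+ 2 +
  2 * s * \int[leb]_(x in `](xi - (M + s)), (xi + s)]) wderiv (e_u d) x ^+ 2.
Proof.
move=> s0 ys; rewrite /L /=; set y := L_y d xi in ys *; set yn := L_y (dn n) xi in ys *.
set a := e_u (dn n) yn; set b := e_u d yn; set c := e_u d y.
set J := \int[leb]_(x in _) _.
suff H : (b - c) ^+ 2 <= s * J by have := sqr_ge0 ((a - b) - (b - c)); nra.
have y1 := L_y_lex d xi; have y2 := L_y_ge d xi.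
have [_ _ _ L2u'] := hu.
have i2 := L2_integrable_sqr L2u'.
have sub (p q : R) : p <= q -> q - p <= s -> xi - (M + s) <= p -> q <= xi + s ->
    (e_u d q - e_u d p) ^+ 2 <= s * J.
  move=> pq qps xip qxi; apply: le_trans (H1_holder hu pq) _.
  have J0 : 0 <= \int[leb]_(x in `]p, q]) wderiv (e_u d) x ^+ 2.
    by apply: Rintegral_ge0 => x _; exact: sqr_ge0.
  apply: ler_pM => //; first by rewrite subr_ge0.
  apply: fine_le.
  - by apply: integrable_fin_num => //; exact: integrableS i2.
  - by apply: integrable_fin_num => //; exact: integrableS i2.
  - apply: ge0_subset_integral => //.
    + by apply: measurable_funTS; exact: measurable_int i2.
    + by move=> x _; rewrite lee_fin sqr_ge0.
    + move=> x /=; rewrite !in_itv/= => /andP[px xq].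
      by rewrite (le_lt_trans xip px) (le_trans xq qxi).
move: ys; rewrite ler_norml -/y => /andP[ys1 ys2].
rewrite -/y in y1 y2; have [yyn|/ltW yny] := leP y yn.
  by apply: sub => //; lra.
by rewrite -sqrrN opprB; apply: sub => //; lra.
Qed.

(** Integrate the pointwise estimate: the first term by pushing forward to dx + mu_n, the second by
    [integral_window], whose factor M + 2s stays bounded. *)
Lemma L_U_cvg_L2 (e : R) : 0 < e ->
  \forall n \near \oo, (norm_L2 (l_U (L (dn n)) \- l_U (L d))%R <= e%:E)%E.
Proof.
move=> e0; have [_ _ _ L2u'] := hu.
have i2 := L2_integrable_sqr L2u'.
pose K1 := \int[leb]_x wderiv (e_u d) x ^+ 2.
have K10 : 0 <= K1 by apply: Rintegral_ge0 => x _; exact: sqr_ge0.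
have M0 : 0 <= M := e_Finfty_ge0 d.
(* For s <= 1 and mass at most M + 1 the final bound 2 (s^2 + s^2 (M + 1)) + 2 s (M + 2s) K1 is at
   most s D. *)
pose D := 2 * (M + 2) * (1 + K1).
have D0 : 0 < D by rewrite !mulr_gt0//; lra.
pose s := Num.min 1 (e ^+ 2 / D).
have s0 : 0 < s by rewrite lt_min ltr01 divr_gt0// exprn_gt0.
have s1 : s <= 1 by rewrite ge_min lexx.
have sD : s * D <= e ^+ 2 by rewrite -ler_pdivlMr// ge_min lexx orbT.
have HuI := near_e_u_uniform s0.
have := cvg_u_L2 Hcvg => /cvge0P Hu2.
have {}Hu2 := Hu2 (fun=> Lnorm_ge0 _ _ _) s s0.
have HyU := Hyu s0; have HM := near_e_Finfty_le.
near=> n.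
have Mn : e_Finfty (dn n) <= M + 1 by near: n.
have un2 : (norm_L2 (e_u (dn n) \- e_u d)%R <= s%:E)%E by near: n.
have unI : forall x, `|(e_u (dn n) \- e_u d) x| <= s by near: n.
have yn : forall xi, `|L_y (dn n) xi - L_y d xi| <= s by near: n.
rewrite (norm_L2_le _ (ltW s0)) in un2.
rewrite (norm_L2_le _ (ltW e0)).
have mv : measurable_fun setT (e_u (dn n) \- e_u d).
  apply: measurable_funB; apply: continuous_measurable_fun; [exact: cun|exact: cu].
have mUn : measurable_fun setT (l_U (L (dn n))).
  by apply: measurableT_comp (measurable_L_y _); exact: continuous_measurable_fun.
have mU : measurable_fun setT (l_U (L d)).
  by apply: measurableT_comp (measurable_L_y _); exact: continuous_measurable_fun.
have mw2 : measurable_fun setT (fun x => wderiv (e_u d) x ^+ 2).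
  by apply/measurable_EFinP; exact: measurable_int i2.
pose f1 xi := ((e_u (dn n) \- e_u d) (L_y (dn n) xi)) ^+ 2.
pose f2 xi := (\int[leb]_(x in `](xi - (M + s))%R, (xi + s)%R])
  (wderiv (e_u d) x ^+ 2)%:E)%E.
have f2E xi : f2 xi =
    (\int[leb]_(x in `](xi - (M + s)), (xi + s)]) wderiv (e_u d) x ^+ 2)%:E.
  rewrite /f2 /Rintegral fineK//; apply: integrable_fin_num => //.
  exact: integrableS i2.
have f20 xi : (0 <= f2 xi)%E by apply: integral_ge0 => x _; rewrite lee_fin sqr_ge0.
have mf1 : measurable_fun setT f1.
  by apply: measurable_funX; exact: measurableT_comp mv (measurable_L_y _).
have mf2 : measurable_fun setT f2.
  have lw : locally_integrable setT (fun x => wderiv (e_u d) x ^+ 2).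
    by apply: open_integrable_locally => //; exact: openT.
  have [G pG] := primitive_exists lw; have cG := primitive_continuous pG.
  have -> : f2 = EFin \o (fun xi => G (xi + s) - G (xi - (M + s))).
    apply/funext => xi; rewrite f2E /=; have [_ ->//] := pG; lra.
  apply/measurable_EFinP; apply: continuous_measurable_fun => x; apply: cvgB.
    apply: (cvg_comp (fun x : R => x + s) G _ (cG (x + s))).
    by apply: cvgD; [exact: cvg_id|exact: cvg_cst].
  apply: (cvg_comp (fun x : R => x - (M + s)) G _ (cG (x - (M + s)))).
  by apply: cvgB; [exact: cvg_id|exact: cvg_cst].
apply: (@le_trans _ _ (\int[leb]_xi (2%:E * (f1 xi)%:E + (2 * s)%:E * f2 xi))%E).
  apply: ge0_le_integral => //.
  - by move=> x _; rewrite lee_fin sqr_ge0.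
  - by apply/measurable_EFinP; apply: measurable_funX; exact: measurable_funB.
  - apply: emeasurable_funD; apply: emeasurable_funM => //.
    exact/measurable_EFinP.
  - move=> xi _; rewrite f2E -!EFinM -EFinD lee_fin.
    exact: L_U_sqr_diff_le (ltW s0) (yn xi).
rewrite ge0_integralD//; last 4 first.
- by move=> x _; rewrite -EFinM lee_fin mulr_ge0// sqr_ge0.
- by apply: emeasurable_funM => //; exact/measurable_EFinP.
- by move=> x _; rewrite mule_ge0// lee_fin mulr_ge0// ltW.
- exact: emeasurable_funM.
rewrite !ge0_integralZl//; last 3 first.
- by rewrite lee_fin mulr_ge0// ltW.
- exact/measurable_EFinP.
- by move=> x _; rewrite lee_fin sqr_ge0.
have := @integral_window R _ (M + s) s _ mw2 (fun x => sqr_ge0 _).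
rewrite -/f2 => ->; last by lra.
have -> : (\int[leb]_x (wderiv (e_u d) x ^+ 2)%:E = K1%:E)%E.
  by rewrite /K1 /Rintegral fineK//; exact: integrable_fin_num.
have H1 : (\int[leb]_xi (f1 xi)%:E <= (s ^+ 2 + s ^+ 2 * (M + 1))%:E)%E.
  apply: le_trans (integral_L_y_sqr_le (dn n) mv unI) _.
  by rewrite EFinD leeD// lee_fin ler_wpM2l// sqr_ge0.
apply: (@le_trans _ _ (2%:E * (s ^+ 2 + s ^+ 2 * (M + 1))%:E +
    (2 * s)%:E * ((M + s + s)%:E * K1%:E))%E).
  by rewrite leeD2r// lee_wpmul2l// lee_fin.
rewrite -!EFinM -EFinD lee_fin (le_trans _ sD)// /D.
have : s ^+ 2 <= s by rewrite expr2 ler_piMl// ltW.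
have : s ^+ 2 * M <= s * M by rewrite ler_wpM2r// expr2 ler_piMl// ltW.
have : s ^+ 2 * K1 <= s * K1 by rewrite ler_wpM2r// expr2 ler_piMl// ltW.
by rewrite expr2; nra.
Unshelve. all: by end_near. Qed.

End Convergence.

(** * Integrals of rhobar_n between moving endpoints *)

Section StrongConvergence.
Context {R : realType}.
Local Notation leb := (@lebesgue_measure R).

Lemma rhobar_sqr_le (d : eulerian R) : in_D d ->
  \int[leb]_x e_rhobar d x ^+ 2 <= e_Finfty d.
Proof.
move=> Hd; have [N HN] := exists_singular_part_carrier Hd.
have [hu L2r _] := Hd; have [_ _ _ L2u'] := hu.
rewrite -lee_fin /Rintegral fineK; last first.
  by apply: integrable_fin_num => //; exact: L2_integrable_sqr.
apply: le_trans (integral_energy_le HN).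
apply: ge0_le_integral => //.
- by move=> x _; rewrite lee_fin sqr_ge0.
- by apply: measurable_int (L2_integrable_sqr L2r).
- apply/measurable_EFinP; apply: measurable_funD; apply: measurable_funX.
    exact: measurable_e_ux.
  exact: measurable_e_rhobar.
- by move=> x _; rewrite lee_fin lerDr sqr_ge0.
Qed.

(** Cauchy-Schwarz with the energy bound on rhobar; the constant depends only on the total mass and
    is therefore uniform along the sequence. *)
Lemma rhobar_primitive_holder (d : eulerian R) (G : R -> R) (u v : R) : in_D d ->
  primitive G (e_rhobar d) -> (G v - G u) ^+ 2 <= `|v - u| * e_Finfty d.
Proof.
move=> Hd pG; wlog uv : u v / u <= v.
  move=> H; have [/H //|/ltW/H] := leP u v.
  by rewrite distrC -sqrrN opprB.
have [lG ->//] := pG; have [_ L2r _] := Hd.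
have i2 := L2_integrable_sqr L2r.
rewrite ger0_norm ?subr_ge0//.
apply: le_trans (Rintegral_sqr_le _ _ _ uv) _.
- exact: L2_measurable.
- exact: locally_integrable_itvoc.
- exact: integrableS i2.
- rewrite ler_wpM2l ?subr_ge0// (le_trans _ (rhobar_sqr_le Hd))//.
  by apply: Rintegral_itv_le => // x; exact: sqr_ge0.
Qed.

Variables (dn : nat -> eulerian R) (d : eulerian R).
Hypothesis Hdn : forall n, in_D (dn n).
Hypothesis Hd : in_D d.
Hypothesis Hcvg : cvg_D dn d.
Local Notation M := (e_Finfty d).

(** Weak convergence is tested on the indicator of the fixed interval ]y(a), y(b)]; replacing its
    endpoints by y_n(a) and y_n(b) costs two Hoelder increments. *)
Lemma rhobar_itv_cvg (a b : R) : a <= b ->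
  \int[leb]_(x in `]L_y (dn n) a, L_y (dn n) b]) e_rhobar (dn n) x @[n --> \oo]
    --> \int[leb]_(x in `]L_y d a, L_y d b]) e_rhobar d x.
Proof.
move=> ab; set ya := L_y d a; set yb := L_y d b.
have yab : ya <= yb by exact: L_y_nd.
have lr n : locally_integrable setT (e_rhobar (dn n)).
  by apply: L2_locally_integrable; case: (Hdn n).
have [G pG] := choice (fun n => primitive_exists (lr n)).
have GE n u v : u <= v -> \int[leb]_(x in `]u, v]) e_rhobar (dn n) x = G n v - G n u.
  by move=> uv; have [_ ->] := pG n.
have Hw : \int[leb]_(x in `]ya, yb]) e_rhobar (dn n) x @[n --> \oo]
    --> \int[leb]_(x in `]ya, yb]) e_rhobar d x.
  have ind (f : R -> R) : \int[leb]_(x in `]ya, yb]) f x =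
      \int[leb]_x (f x * \1_(`]ya, yb]) x).
    rewrite Rintegral_mkcond; apply: eq_Rintegral => x _.
    by rewrite patchE indicE; case: (_ \in _); rewrite ?mulr1 ?mulr0.
  rewrite ind; under eq_cvg do rewrite ind.
  apply: (cvg_rhobar Hcvg); apply: L2P; first exact: measurable_indic.
  have -> : (\int[leb]_x ((\1_(`]ya, yb]) x : R) ^+ 2)%:E = leb `]ya, yb]%classic)%E.
    rewrite -[in RHS](setIT `]ya, yb]%classic) -integral_indic//.
    by apply: eq_integral => x _; rewrite indicE; case: (_ \in _); rewrite ?expr1n ?expr0n.
  have /= -> := @lebesgue_measure_itv R `]ya, yb].
  by case: ifP => // _; rewrite -EFinD ltry.
apply/cvgrPdist_le => e e0.
have e30 : 0 < e / 3 by lra.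
have M0 : 0 <= M := e_Finfty_ge0 d.
(* Endpoint shifts up to [del] change the primitive by at most e/3, as the masses are eventually at
   most M + 1. *)
pose del := (e / 3) ^+ 2 / (M + 1).
have del0 : 0 < del by rewrite divr_gt0 ?exprn_gt0//; lra.
have delE : del * (M + 1) = (e / 3) ^+ 2 by rewrite divfK// gt_eqF//; lra.
have HM := near_e_Finfty_le Hcvg.
have Hy := L_y_cvg_uniform (cvg_F Hcvg) (cvg_Finfty Hcvg) del0.
have /cvgrPdist_le/(_ _ e30) Hwn := Hw.
near=> n.
have Mn : e_Finfty (dn n) <= M + 1 by near: n.
have yn : forall xi, `|L_y (dn n) xi - L_y d xi| <= del by near: n.
have Gle u v : `|v - u| <= del -> `|G n v - G n u| <= e / 3.
  move=> uv; have H := rhobar_primitive_holder u v (Hdn n) (pG n).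
  rewrite -(@ler_pXn2r _ 2) ?nnegrE ?(ltW e30)// real_normK ?num_real//.
  by apply: le_trans H _; rewrite -delE ler_pM// e_Finfty_ge0.
have H1 := Gle _ _ (yn a); have H2 := Gle _ _ (yn b).
have H3 : `|\int[leb]_(x in `]ya, yb]) e_rhobar d x - (G n yb - G n ya)| <= e / 3.
  by rewrite -GE//; near: n.
move: H1 H2 H3; rewrite (GE n _ _ (L_y_nd (dn n) ab)) -/ya -/yb !ler_norml.
move=> /andP[? ?] /andP[? ?] /andP[? ?].
by apply/andP; split; lra.
Unshelve. all: by end_near. Qed.

End StrongConvergence.

(** * Strong convergence of (U_xi, rbar, h) and the conclusion *)

Section ProfileConvergence.
Context {R : realType}.
Local Notation leb := (@lebesgue_measure R).
Variables (dn : nat -> eulerian R) (d : eulerian R).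
Hypothesis Hdn : forall n, in_D (dn n).
Hypothesis Hd : in_D d.
Hypothesis Hcvg : cvg_D dn d.
Local Notation M := (e_Finfty d).
Variables (An Bn hn : nat -> R -> R) (A B h : R -> R).
Hypothesis Pn : forall n, L_profile (dn n) (An n) (Bn n) (hn n).
Hypothesis P : L_profile d A B h.

Let bounded_itv (f : R -> R) (a b : R) : measurable_fun setT f ->
  (forall x, `|f x| <= 1) -> leb.-integrable `]a, b] (EFin \o f).
Proof. exact: bounded_integrable_itv. Qed.

Lemma weak_cvg_diff (fn : nat -> R -> R) (f g : R -> R) (a b : R) :
  (forall n, measurable_fun setT (fn n)) -> measurable_fun setT f ->
  (forall n x, `|fn n x| <= 1) -> (forall x, `|f x| <= 1) ->
  (forall u v, u <= v -> \int[leb]_(x in `]u, v]) fn n x @[n --> \oo] -->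
                         \int[leb]_(x in `]u, v]) f x) ->
  measurable_fun setT g -> (forall x, `|g x| <= 1) ->
  \int[leb]_(x in `]a, b]) ((fn n x - f x) * g x) @[n --> \oo] --> (0 : R).
Proof.
move=> mfn mf fn1 f1 H mg g1; apply: (@bounded_weak_cvg _ 2) => //.
- by move=> n; exact: measurable_funB.
- move=> n x; rewrite (le_trans (ler_normB _ _))//.
  by rewrite (le_trans (lerD (fn1 n x) (f1 x))).
- move=> u v uv.
  have -> : (fun n => \int[leb]_(x in `]u, v]) (fn n x - f x)) =
      (fun n => \int[leb]_(x in `]u, v]) fn n x - \int[leb]_(x in `]u, v]) f x).
    by apply/funext => n; rewrite RintegralB//; exact: bounded_itv.
  rewrite -[X in _ --> X](subrr (\int[leb]_(x in `]u, v]) f x)).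
  by apply: cvgB; [exact: H|exact: cvg_cst].
Qed.

Let hn1 n x : `|hn n x| <= 1. Proof. exact: prof_h_norm_le1 (Pn n) x. Qed.
Let h1 x : `|h x| <= 1. Proof. exact: prof_h_norm_le1 P x. Qed.
Let mhn n : measurable_fun setT (hn n). Proof. exact: prof_meash (Pn n). Qed.
Let mh : measurable_fun setT h. Proof. exact: prof_meash P. Qed.
Let mAn n : measurable_fun setT (An n). Proof. exact: prof_measA (Pn n). Qed.
Let mA : measurable_fun setT A. Proof. exact: prof_measA P. Qed.
Let mBn n : measurable_fun setT (Bn n). Proof. exact: prof_measB (Pn n). Qed.
Let mB : measurable_fun setT B. Proof. exact: prof_measB P. Qed.

Let hE (d' : eulerian R) (A' B' h' : R -> R) (u v : R) : L_profile d' A' B' h' ->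
  u <= v -> \int[leb]_(x in `]u, v]) h' x = (v - L_y d' v) - (u - L_y d' u).
Proof.
move=> P' uv; have [_ H] := prof_zeta P'.
rewrite -[RHS]opprK -[LHS]opprK; congr (- _).
have /= -> : - (v - L_y d' v - (u - L_y d' u)) =
  l_zeta (L d') v - l_zeta (L d') u by rewrite /L /=; ring.
rewrite H// -mulN1r -RintegralZl//; first by apply: eq_Rintegral => x _; rewrite mulN1r.
apply: bounded_itv; first exact: prof_meash P'.
exact: prof_h_norm_le1 P'.
Qed.

Lemma L_h_weak (u v : R) : u <= v ->
  \int[leb]_(x in `]u, v]) hn n x @[n --> \oo] --> \int[leb]_(x in `]u, v]) h x.
Proof.
move=> uv; rewrite (hE P uv); under eq_cvg do rewrite (hE (Pn _) uv).
by apply: cvgB; apply: cvgB; [exact: cvg_cst|apply: L_y_cvg; exact: cvg_F Hcvg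
  |exact: cvg_cst|apply: L_y_cvg; exact: cvg_F Hcvg].
Qed.

Lemma L_A_weak (u v : R) : u <= v ->
  \int[leb]_(x in `]u, v]) An n x @[n --> \oo] --> \int[leb]_(x in `]u, v]) A x.
Proof.
move=> uv; have [_ <-//] := prof_U P.
have -> : (fun n => \int[leb]_(x in `]u, v]) An n x) =
    (fun n => l_U (L (dn n)) v - l_U (L (dn n)) u).
  by apply/funext => n; have [_ <-] := prof_U (Pn n).
by apply: cvgB; exact: L_U_pointwise_cvg.
Qed.

Lemma L_B_weak (u v : R) : u <= v ->
  \int[leb]_(x in `]u, v]) Bn n x @[n --> \oo] --> \int[leb]_(x in `]u, v]) B x.
Proof.
move=> uv; rewrite (prof_B P uv); under eq_cvg do rewrite (prof_B (Pn _) uv).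
exact: rhobar_itv_cvg.
Qed.

Let q n x := (An n x - A x) ^+ 2 + (Bn n x - B x) ^+ 2 + (hn n x - h x) ^+ 2.

Lemma profile_diff_ge0 n x : 0 <= q n x.
Proof. by rewrite !addr_ge0 ?sqr_ge0. Qed.

(** |v_n - v|^2 <= 2 |v_n|^2 + 2 |v|^2, and |v|^2 = h on the sphere; used where there is no weak
    convergence, on the tails. *)
Lemma profile_diff_le n x : q n x <= 2 * hn n x + 2 * h x.
Proof.
have := prof_sphere (Pn n) x; have := prof_sphere P x; rewrite /q.
have := sqr_ge0 (An n x + A x); have := sqr_ge0 (Bn n x + B x).
by have := sqr_ge0 (hn n x + h x); nra.
Qed.

(* On the sphere h = h^2 + A^2 + B^2 the squared distance is affine in the    *)
(* first vector, so that weak convergence suffices.                           *)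
Lemma profile_diffE n x : q n x = (hn n x - h x) * 1 -
  2 * ((An n x - A x) * A x + (Bn n x - B x) * B x + (hn n x - h x) * h x).
Proof.
have := prof_sphere (Pn n) x; have := prof_sphere P x; rewrite /q => Hh Hhn.
lra.
Qed.

Lemma measurable_profile_diff n : measurable_fun setT (q n).
Proof.
by apply: measurable_funD; first apply: measurable_funD;
  apply: measurable_funX; exact: measurable_funB.
Qed.

Lemma profile_diff_itv_cvg (a b : R) :
  \int[leb]_(x in `]a, b]) q n x @[n --> \oo] --> (0 : R).
Proof.
(* The linear term h_n - h is tested against the constant 1, which explains the factor 1 in
   [profile_diffE]. *)
have H1 := weak_cvg_diff a b mhn mh hn1 h1 L_h_weak (measurable_cst (1 : R))
  (fun=> eq_ind_r (fun z => z <= 1) (lexx 1) (normr1 _)).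
have Hh := weak_cvg_diff a b mhn mh hn1 h1 L_h_weak mh h1.
have A1n n x := prof_A_le1 (Pn n) x; have A1 x := prof_A_le1 P x.
have B1n n x := prof_B_le1 (Pn n) x; have B1 x := prof_B_le1 P x.
have HA := weak_cvg_diff a b mAn mA A1n A1 L_A_weak mA A1.
have HB := weak_cvg_diff a b mBn mB B1n B1 L_B_weak mB B1.
have int2 (f g k : R -> R) : measurable_fun setT f -> measurable_fun setT g ->
    measurable_fun setT k ->
    (forall x, `|f x| <= 1) -> (forall x, `|g x| <= 1) -> (forall x, `|k x| <= 1) ->
    leb.-integrable `]a, b] (EFin \o (fun x => (f x - g x) * k x)).
  move=> mf mg mk f1 g1 k1; apply: (@bounded_integrable_itv _ _ _ _ 2).
    by apply: measurable_funM => //; exact: measurable_funB.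
  move=> x; rewrite normrM -[2]mulr1 ler_pM//.
  rewrite (le_trans (ler_normB _ _))//.
  by rewrite (le_trans (lerD (f1 x) (g1 x))).
have i1 n : leb.-integrable `]a, b] (EFin \o (fun x => (hn n x - h x) * 1)).
  by apply: int2 => // x; rewrite normr1.
have iA n : leb.-integrable `]a, b] (EFin \o (fun x => (An n x - A x) * A x)).
  exact: int2.
have iB n : leb.-integrable `]a, b] (EFin \o (fun x => (Bn n x - B x) * B x)).
  exact: int2.
have ih n : leb.-integrable `]a, b] (EFin \o (fun x => (hn n x - h x) * h x)).
  exact: int2.
have iS n : leb.-integrable `]a, b] (EFin \o (fun x =>
    (An n x - A x) * A x + (Bn n x - B x) * B x + (hn n x - h x) * h x)).
  exact: (integrableD _ (integrableD _ (iA n) (iB n)) (ih n)).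
have iAB n : leb.-integrable `]a, b] (EFin \o (fun x =>
    (An n x - A x) * A x + (Bn n x - B x) * B x)).
  exact: (integrableD _ (iA n) (iB n)).
have -> : (fun n => \int[leb]_(x in `]a, b]) q n x) = (fun n =>
    \int[leb]_(x in `]a, b]) ((hn n x - h x) * 1) -
    2 * (\int[leb]_(x in `]a, b]) ((An n x - A x) * A x) +
         \int[leb]_(x in `]a, b]) ((Bn n x - B x) * B x) +
         \int[leb]_(x in `]a, b]) ((hn n x - h x) * h x))).
  apply/funext => n; under eq_Rintegral do rewrite profile_diffE.
  rewrite RintegralB//; last first.
    have -> : EFin \o (fun x => 2 * ((An n x - A x) * A x +
        (Bn n x - B x) * B x + (hn n x - h x) * h x)) =
      (fun x => 2%:E * (EFin \o (fun x => ((An n x - A x) * A x +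
        (Bn n x - B x) * B x + (hn n x - h x) * h x)%R)) x)%E by apply/funext.
    exact: integrableZl.
  by rewrite RintegralZl// RintegralD// RintegralD.
have -> : (0 : R) = 0 - 2 * (0 + 0 + 0) by ring.
apply: cvgB; first exact: H1.
apply: cvgM; first exact: cvg_cst.
by apply: cvgD; first apply: cvgD.
Qed.

Lemma prof_tail (d' : eulerian R) (A' B' h' : R -> R) (b : R) :
  L_profile d' A' B' h' ->
  (\int[leb]_(x in `]b, +oo[) (h' x)%:E = (e_Finfty d' - (b - L_y d' b))%:E)%E.
Proof.
move=> P'; have mh' := prof_meash P'.
have : (\int[leb]_x (h' x)%:E = \int[leb]_(x in `]-oo, b]) (h' x)%:E +
    \int[leb]_(x in `]b, +oo[) (h' x)%:E)%E.
  rewrite -ge0_integral_setU//.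
  - by rewrite -itv_bndbnd_setU// set_itvNyy.
  - by apply/measurable_EFinP; exact: measurable_funTS mh'.
  - by move=> t _; rewrite lee_fin (prof_h_ge0 P').
  - apply/disj_setPS => t [/=]; rewrite !in_itv/= => tx /andP[].
    by rewrite ltNge tx.
rewrite (prof_HT P') (prof_H P') => HH.
by rewrite EFinB HH [X in (_ = X - _)%E]addeC addeK.
Qed.

Lemma integral_profile_diff_le n (D : set (measurableTypeR R)) : measurable D ->
  (\int[leb]_(x in D) (q n x)%:E <=
   2%:E * \int[leb]_(x in D) (hn n x)%:E + 2%:E * \int[leb]_(x in D) (h x)%:E)%E.
Proof.
move=> mD.
have mq := measurable_profile_diff n.
have mE (f : R -> R) : measurable_fun setT f -> measurable_fun D (EFin \o f).
  by move=> mf; apply/measurable_EFinP; exact: measurable_funTS mf.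
have hn0 x : 0 <= hn n x := prof_h_ge0 (Pn n) x.
have h0 x : 0 <= h x := prof_h_ge0 P x.
rewrite -!ge0_integralZl//; try by [move=> x _; rewrite lee_fin|exact: mE].
rewrite -ge0_integralD//; try by [move=> x _; rewrite -EFinM lee_fin mulr_ge0
  |apply: emeasurable_funM => //; exact: mE].
apply: ge0_le_integral => //.
- by move=> x _; rewrite lee_fin profile_diff_ge0.
- exact: mE.
- by apply: emeasurable_funD; apply: emeasurable_funM => //; exact: mE.
- by move=> x _; rewrite -!EFinM -EFinD lee_fin profile_diff_le.
Qed.

(** On ]a, b] weak convergence is enough. On the two tails the integrals of h_n are a - y_n(a) and
    mu_n(R) - (b - y_n(b)), which converge to the small tails of [h]. *)
Lemma profile_diff_cvg (e : R) : 0 < e ->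
  \forall n \near \oo, (\int[leb]_x (q n x)%:E <= e%:E)%E.
Proof.
move=> e0; have e20 : 0 < e / 20 by lra.
(* In units of e/20 the left tail costs at most 6, the right tail 8 and the middle 1. *)
have [a [b [ab Ha Hb]]] := L_y_tails d e20.
have Hy := L_y_cvg_uniform (cvg_F Hcvg) (cvg_Finfty Hcvg) e20.
have /cvgrPdist_le/(_ _ e20) HM := cvg_Finfty Hcvg.
have /cvgrPdist_le/(_ _ e20) Hq := profile_diff_itv_cvg a b.
near=> n.
have Mn : `|M - e_Finfty (dn n)| <= e / 20 by near: n.
have yn : forall xi, `|L_y (dn n) xi - L_y d xi| <= e / 20 by near: n.
have qn : `|0 - \int[leb]_(x in `]a, b]) q n x| <= e / 20 by near: n.
have mq := measurable_profile_diff n.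
have q0 x : 0 <= q n x := profile_diff_ge0 n x.
have mqE (D : set (measurableTypeR R)) : measurable_fun D (EFin \o q n).
  by apply/measurable_EFinP; exact: measurable_funTS mq.
have -> : (\int[leb]_x (q n x)%:E = \int[leb]_(x in `]-oo, b]) (q n x)%:E +
    \int[leb]_(x in `]b, +oo[) (q n x)%:E)%E.
  rewrite -ge0_integral_setU//.
  - by rewrite -itv_bndbnd_setU// set_itvNyy.
  - by move=> t _; rewrite lee_fin.
  - apply/disj_setPS => t [/=]; rewrite !in_itv/= => tx /andP[].
    by rewrite ltNge tx.
have -> : (\int[leb]_(x in `]-oo, b]) (q n x)%:E =
    \int[leb]_(x in `]-oo, a]) (q n x)%:E + \int[leb]_(x in `]a, b]) (q n x)%:E)%E.
  rewrite -ge0_integral_setU//.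
  - by rewrite -itv_bndbnd_setU.
  - by move=> t _; rewrite lee_fin.
  - apply/disj_setPS => t [/=]; rewrite !in_itv/= => tx /andP[].
    by rewrite ltNge tx.
have -> : (\int[leb]_(x in `]a, b]) (q n x)%:E =
    (\int[leb]_(x in `]a, b]) q n x)%:E)%E.
  rewrite /Rintegral fineK//; apply: integrable_fin_num => //.
  apply: (@bounded_integrable_itv _ _ _ _ 4) => // x.
  rewrite ger0_norm// (le_trans (profile_diff_le n x))//.
  by have := prof_h_le1 (Pn n) x; have := prof_h_le1 P x; lra.
have Hl := integral_profile_diff_le n (measurable_itv `]-oo, a]).
have Hr := integral_profile_diff_le n (measurable_itv `]b, +oo[).
move: Hl Hr; rewrite (prof_H P) (prof_H (Pn n)) (prof_tail _ P) (prof_tail _ (Pn n)).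
rewrite -!EFinM -!EFinD => Hl Hr.
apply: le_trans (leeD (leeD Hl (lexx _)) Hr) _.
rewrite -!EFinD lee_fin.
have := yn a; have := yn b; move: Mn qn; rewrite !ler_norml.
by move=> /andP[? ?] /andP[? ?] /andP[? ?] /andP[? ?]; lra.
Unshelve. all: by end_near. Qed.

Lemma norm_L2_le_profile_diff n (f g : R -> R) (e : R) : 0 <= e ->
  measurable_fun setT f -> measurable_fun setT g ->
  {ae leb, forall x, g x = f x} -> (forall x, f x ^+ 2 <= q n x) ->
  (\int[leb]_x (q n x)%:E <= (e ^+ 2)%:E)%E -> (norm_L2 g <= e%:E)%E.
Proof.
move=> e0 mf mg gf fq qe; rewrite norm_L2_le// (ae_eq_integral_sqr mg mf gf).
apply: le_trans qe; apply: ge0_le_integral => //.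
- by move=> x _; rewrite lee_fin sqr_ge0.
- by apply/measurable_EFinP; exact: measurable_funX.
- by apply/measurable_EFinP; exact: measurable_profile_diff.
- by move=> x _; rewrite lee_fin.
Qed.

Lemma measurable_l_rbar (d' : eulerian R) (A' B' h' : R -> R) : in_D d' ->
  L_profile d' A' B' h' -> measurable_fun setT (l_rbar (L d')).
Proof.
move=> Hd' P'; apply: measurable_funM; last exact: measurable_wderiv (prof_y P').
exact: measurableT_comp (measurable_e_rhobar Hd') (measurable_L_y d').
Qed.

Lemma L_cvg_E : cvg_E (fun n => L (dn n)) (L d).
Proof.
have normE_ge0 X : (0 <= norm_E X)%E.
  by rewrite /norm_E /norm_V /norm_H1 !adde_ge0// ?Lnorm_ge0// ?poweR_ge0.
apply/cvge0P => // e e0.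
pose s := e / 7; have s0 : 0 < s by rewrite /s; lra.
have s20 : 0 < s ^+ 2 by rewrite exprn_gt0.
have Hq := profile_diff_cvg s20.
have Hy := L_y_cvg_uniform (cvg_F Hcvg) (cvg_Finfty Hcvg) s0.
have HU := L_U_cvg_L2 Hdn Hd Hcvg s0.
have /cvgrPdist_le/(_ _ s0) Hk := cvg_k Hcvg.
near=> n.
have qn : (\int[leb]_x (q n x)%:E <= (s ^+ 2)%:E)%E by near: n.
have yn : forall xi, `|L_y (dn n) xi - L_y d xi| <= s by near: n.
have Un : (norm_L2 (l_U (L (dn n)) \- l_U (L d))%R <= s%:E)%E by near: n.
have kn : `|e_k d - e_k (dn n)| <= s by near: n.
have qA x : (An n x - A x) ^+ 2 <= q n x.
  rewrite /q; have := sqr_ge0 (Bn n x - B x); have := sqr_ge0 (hn n x - h x); lra.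
have qB x : (Bn n x - B x) ^+ 2 <= q n x.
  rewrite /q; have := sqr_ge0 (An n x - A x); have := sqr_ge0 (hn n x - h x); lra.
have qh x : (hn n x - h x) ^+ 2 <= q n x.
  rewrite /q; have := sqr_ge0 (An n x - A x); have := sqr_ge0 (Bn n x - B x); lra.
have pz := primitiveB (prof_zeta (Pn n)) (prof_zeta P).
have pU := primitiveB (prof_U (Pn n)) (prof_U P).
have H1 : (norm_Linfty (l_zeta (L (dn n)) \- l_zeta (L d))%R <= s%:E)%E.
  apply: norm_Linfty_le; apply: aeW => xi.
  have -> : (l_zeta (L (dn n)) \- l_zeta (L d)) xi = L_y (dn n) xi - L_y d xi.
    by rewrite /L /=; ring.
  exact: yn.
have H2 : (norm_L2 (wderiv (l_zeta (L (dn n)) \- l_zeta (L d))%R) <= s%:E)%E.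
  apply: (norm_L2_le_profile_diff (ltW s0) _ (measurable_wderiv pz) (wderiv_ae pz)) qn.
    by apply: measurable_funB; exact: measurable_funN.
  by move=> x; rewrite /= -opprD sqrrN.
have H3 : (norm_L2 (wderiv (l_U (L (dn n)) \- l_U (L d))%R) <= s%:E)%E.
  apply: (norm_L2_le_profile_diff (ltW s0) _ (measurable_wderiv pU)
    (wderiv_ae pU)) qn => //.
  exact: measurable_funB.
have H4 : (norm_L2 (l_h (L (dn n)) \- l_h (L d))%R <= s%:E)%E.
  apply: (@norm_L2_le_profile_diff n (hn n \- h)) qn => //.
  - exact: ltW.
  - exact: measurable_funB.
  - apply: measurable_funB; first exact: measurable_lh (Pn n).
    exact: measurable_lh P.
  - by apply: ae_imply2 (prof_lh (Pn n)) (prof_lh P) => x /= -> ->.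
have H5 : (norm_L2 (l_rbar (L (dn n)) \- l_rbar (L d))%R <= s%:E)%E.
  apply: (@norm_L2_le_profile_diff n (Bn n \- B)) qn => //.
  - exact: ltW.
  - exact: measurable_funB.
  - apply: measurable_funB; first exact: measurable_l_rbar (Pn n).
    exact: measurable_l_rbar P.
  - by apply: ae_imply2 (prof_rbar (Pn n)) (prof_rbar P) => x /= -> ->.
have H6 := norm_H1_le (ltW s0) Un H3.
rewrite /norm_E /norm_V /l_sub /=.
have -> : e = s + s + 2 * s + s + s + s by rewrite /s; lra.
rewrite !EFinD !leeD//.
by rewrite lee_fin distrC.
Unshelve. all: by end_near. Qed.

End ProfileConvergence.

Theorem theorem5p1 (R : realType) (dn : nat -> eulerian R) (d : eulerian R)
    (Hdn : forall n, in_D (dn n)) (Hd : in_D d) (Hcvg : cvg_D dn d) :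
  (forall n, in_F0 (L (dn n))) /\ in_F0 (L d) /\
  cvg_E (fun n => L (dn n)) (L d).
Proof.
split; first by move=> n; exact: L_in_F0.
split; first exact: L_in_F0.
have [A [B [h P]]] := L_profile_exists Hd.
have /choice[An /choice[Bn /choice[hn Pn]]] := fun n => L_profile_exists (Hdn n).
exact: (L_cvg_E Hdn Hd Hcvg Pn P).
Qed.
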